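(* Let $n,m\geq 1$ be integers, let $k$ be a finite field with $\operatorname{char} k\neq 2$, and let $f_1,\dots,f_m\in k[x_1,\dots,x_n]$. The following are equivalent: (i) If $\varepsilon_1,\dots,\varepsilon_m\in\{0,1,-1\}$ and $\lambda\in k^*$ are such that $\lambda\prod_{i=1}^m f_i^{\varepsilon_i}$ is a square in the rational function field $k(x_1,\dots,x_n)$, then $\varepsilon_1=\dots=\varepsilon_m=0$. (ii) For every finite field $\mathbb{F}_q\supset k$ and every subset $S\subset\{1,\dots,m\}$, the number of $\underline{x}=(x_1,\dots,x_n)\in\mathbb{F}_q^n$ such that $f_i(\underline{x})$ is a nonzero square in $\mathbb{F}_q$ for all $i\in S$ and a non-square in $\mathbb{F}_q$ for all $i\notin S$ equals $q^n/2^m+O(q^{n-1/2})$; that is, there is a constant $C$, independent of $\mathbb{F}_q$ and $S$, such that this number differs from $q^n/2^m$ by at most $Cq^{n-1/2}$ in absolute value for all such $\mathbb{F}_q$ and $S$. When (i) and (ii) hold, the implied constant $C$ in (ii) can be taken to depend only on $n$, $m$ and the degrees of $f_1,\dots,f_m$.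
   Context: A non-square in $\mathbb{F}_q$ is an element of $\mathbb{F}_q$ that is not the square of an element of $\mathbb{F}_q$ (in particular it is nonzero). If some $f_i$ is the zero polynomial, condition (i) is regarded as failing (take $\varepsilon_i=1$ and all other $\varepsilon_j=0$, so that the product is $0$, a square). *)

(* Defs.v *)
From mathcomp Require Import all_boot all_order all_algebra.
From mathcomp Require Import reals.
From mathcomp Require Import mpoly.

Set Implicit Arguments.
Unset Strict Implicit.
Unset Printing Implicit Defensive.

Import GRing.Theory Num.Theory.
Local Open Scope ring_scope.

Definition is_square (A : comNzRingType) (a : A) : Prop :=
  exists b : A, a = b ^+ 2.

Definition is_squareb (F : finFieldType) (a : F) : bool :=
  [exists b : F, a == b ^+ 2].

Definition ratfun (n : nat) (k : fieldType) : fieldType :=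
  {fraction {mpoly k[n]}}.

Definition to_ratfun (n : nat) (k : fieldType) (p : {mpoly k[n]}) :
  ratfun n k := FracField.tofrac p.

(* Exponents are integers. Since 0 ^ 1 = 0 is a square, this predicate fails
   as soon as some f i is 0. *)
Definition square_independent (n m : nat) (k : fieldType)
    (f : 'I_m -> {mpoly k[n]}) : Prop :=
  forall (eps : 'I_m -> int) (lambda : k),
    (forall i, eps i \in [:: 0; 1; -1]) ->
    lambda != 0 ->
    is_square (to_ratfun lambda%:MP * \prod_(i < m) to_ratfun (f i) ^ eps i) ->
    forall i, eps i = 0.

(* An extension of k is a finite field F with a morphism iota : k -> F
   (injective, as k is a field). The elements of F that are not squares are
   nonzero because 0 = 0 ^+ 2. *)
Definition pattern_count (n m : nat) (k : fieldType)
    (f : 'I_m -> {mpoly k[n]}) (F : finFieldType) (iota : {rmorphism k -> F})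
    (S : {set 'I_m}) : nat :=
  #|[set x : {ffun 'I_n -> F} | [forall i : 'I_m,
       let y := (map_mpoly iota (f i)).@[x] in
       if i \in S then (y != 0) && is_squareb y else ~~ is_squareb y]]|.

(* q ^+ n / Num.sqrt q is q^(n - 1/2). *)
Definition equidistributed_with (R : realType) (n m : nat) (k : fieldType)
    (f : 'I_m -> {mpoly k[n]}) (C : R) : Prop :=
  forall (F : finFieldType) (iota : {rmorphism k -> F}) (S : {set 'I_m}),
    let q : R := #|F|%:R in
    `|(pattern_count f iota S)%:R - q ^+ n / 2 ^+ m|
      <= C * (q ^+ n / Num.sqrt q).

Definition equidistributed (R : realType) (n m : nat) (k : fieldType)
    (f : 'I_m -> {mpoly k[n]}) : Prop :=
  exists C : R, equidistributed_with f C.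

(* Total degrees; msize is the total degree plus one on nonzero polynomials,
   and the zero polynomial gets degree 0 here. *)
Definition degrees (n m : nat) (k : fieldType) (f : 'I_m -> {mpoly k[n]}) :
  {ffun 'I_m -> nat} := [ffun i => (msize (f i)).-1].

(* Main.v *)
From HB Require Import structures.
Require Import Defs.
From mathcomp Require Import all_boot all_order all_algebra all_fingroup.
From mathcomp Require Import all_solvable all_field.
From mathcomp Require Import reals.
From mathcomp Require Import mpoly.
From mathcomp Require Import ring lra zify.

(** At a point where no [f_i] vanishes, the indicator of the sign pattern [S]
    is the product of the [(1 + s_i chi(f_i)) / 2], where [chi] is the quadratic
    character and [s_i] is 1 or -1 according to [S]. Expanding it over the
    subsets [T] of the indices and summing over all points gives [q ^ n / 2 ^ m]
    for the empty [T], and for the others the sums of [chi(f_T)], where [f_T] is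
    the product of the [f_i] with [i] in [T]. Independence implies that no
    such [f_T] is a scalar times a square, so equidistribution reduces to one
    estimate, [square_or_char_sum_bound]: either [f] is a scalar times a
    square over [k], or its character sum over every extension is at most [C q
    ^ (n - 1/2)], with [C] depending on [n] and [deg f] only. The points where
    some [f_i] vanishes number [O(q ^ (n - 1))].

    For one variable this is Weil's bound, obtained by Stepanov's method
    ([sum_quad_char_bound]): a nonzero polynomial of controlled degree is built
    that vanishes to high order at all points where [f] is a nonzero square, or
    at all points where it is a non-square, so that neither set exceeds [q / 2]
    by more than [O(sqrt q)].

    For several variables, [f] is viewed as a polynomial [P] in the last one,
    and the bound of one variable is applied to its slices. The slices to avoid
    are those that become a scalar times a square. If [deg P] is odd, the leading
    coefficient vanishes there. If it is even, they are controlled by an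
    approximate square root ([approx_sqrt]), an identity
    [b ^ 2 P = c G ^ 2 + R] with [c] the leading coefficient of [P] and
    [deg R] less than half of [deg P]: if [R] is not 0 then only the slices in a
    hypersurface are bad ([sqrt_remainder_not_square]), and if [R = 0] then [f]
    can be replaced by [c], which has one variable less. The identity has
    coefficients of bounded degree over [k], and is specialized to the
    extensions; this gives the uniformity, and makes it unnecessary to descend
    a square from an extension to [k].

    Conversely, if [lambda] times a product of the [f_i ^ (eps_i)] is a square
    and some [eps_i] is not 0, then outside a hypersurface the signs of the
    [f_i] satisfy a parity condition, which excludes some pattern
    ([pattern_set_zeros]). Over a large extension, equidistribution would give this pattern
    about [q ^ n / 2 ^ m] points, more than the hypersurface contains
    ([equidistributed_many]). *)

Set Implicit Arguments.
Unset Strict Implicit.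
Unset Printing Implicit Defensive.

Import Order.TTheory GRing.Theory Num.Theory.
Local Open Scope ring_scope.

(** * The substitution X |-> X + f(X) T *)

Section Stretch.
Variables (F : fieldType) (f : {poly F}).

(** [stretch p] is [p(X + f(X) T)], a polynomial in [T] (outer variable) with
    coefficients in [F[X]]. The coefficient of [T ^ k] is [f ^ k] times the
    [k]-th Hasse derivative of [p], so this one ring morphism replaces the
    Leibniz rule for Hasse derivatives; the factor [f ^ k] clears the
    denominators that appear when a power of [f] is differentiated. *)
Definition stretch : {poly F} -> {poly {poly F}} :=
  comp_poly (f%:P * 'X + 'X%:P) \o map_poly polyC.

HB.instance Definition _ := GRing.RMorphism.copy stretch
  (comp_poly (f%:P * 'X + 'X%:P) \o map_poly polyC).

Lemma stretchC c : stretch c%:P = c%:P%:P.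
Proof. by rewrite /stretch /= map_polyC comp_polyC. Qed.

Lemma stretchB p q : stretch (p - q) = stretch p - stretch q.
Proof. exact: rmorphB. Qed.

Lemma stretchX : stretch 'X = f%:P * 'X + 'X%:P.
Proof. by rewrite /stretch /= map_polyX comp_polyX. Qed.

Lemma stretch_congr p : exists Q, stretch p = p%:P + f%:P * Q.
Proof.
elim/poly_ind: p => [|p c [Q IH]]; first by exists 0; rewrite rmorph0 polyC0 mulr0 addr0.
exists ('X * (p%:P + f%:P * Q) + Q * 'X%:P).
rewrite rmorphD rmorphM /= stretchX stretchC IH polyCD polyCM; ring.
Qed.

(** The coefficient of [T ^ i] has degree at most [s + i * deg f]. Giving [T]
    this weight makes the bound additive under products. *)
Definition graded s (P : {poly {poly F}}) :=
  forall i : nat, (size (P`_i)%R <= (s + i * (size f).-1).+1)%N.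

Lemma gradedD s P Q : graded s P -> graded s Q -> graded s (P + Q).
Proof.
move=> hP hQ i; rewrite coefD (leq_trans (size_polyD _ _)) // geq_max.
by rewrite hP hQ.
Qed.

Lemma gradedM s t P Q : graded s P -> graded t Q -> graded (s + t) (P * Q).
Proof.
move=> hP hQ i; rewrite coefM (leq_trans (size_sum _ _ _)) //.
apply/bigmax_leqP => j _; rewrite (leq_trans (size_polyMleq _ _)) //.
have := hP j; have := hQ (i - j)%N.
have -> : (i * (size f).-1 = j * (size f).-1 + (i - j) * (size f).-1)%N.
  by rewrite -mulnDl subnKC // -ltnS ltn_ord.
move: (j * _)%N ((i - j) * _)%N (size P`_j) => a b u; lia.
Qed.

Lemma graded0 s : graded s 0.
Proof. by move=> i; rewrite coef0 size_poly0. Qed.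

Lemma gradedC s (p : {poly F}) : (size p <= s.+1)%N -> graded s p%:P.
Proof.
move=> hp i; rewrite coefC; case: eqP => [->|_]; last by rewrite size_poly0.
by rewrite mul0n addn0.
Qed.

Lemma gradedXn s P n : graded s P -> graded (n * s) (P ^+ n).
Proof.
move=> hP; elim: n => [|n IH].
  by rewrite expr0 -polyC1; apply: gradedC; rewrite size_poly1.
by rewrite exprS mulSn; apply: gradedM.
Qed.

Lemma graded_stretchX : graded 1 (stretch 'X).
Proof.
rewrite stretchX => -[|[|i]]; rewrite coefD coefMX coefC /= ?add0r ?addr0 ?coefC /=.
- by rewrite size_polyX.
- by rewrite mul1n addr0; case: (size f).
- by rewrite size_poly0.
Qed.

Lemma graded_stretch s (p : {poly F}) :
  (size p <= s.+1)%N -> graded s (stretch p).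
Proof.
elim/poly_ind: p s => [|p c IH] s hs; first by rewrite rmorph0; apply: graded0.
rewrite rmorphD rmorphM /= stretchC; apply: gradedD; last first.
  by apply: gradedC; rewrite (leq_trans (size_polyC_leq1 _)).
have [->|p0] := eqVneq p 0; first by rewrite rmorph0 mul0r; apply: graded0.
move: hs; rewrite size_MXaddC (negbTE p0) /= => hs.
have sp : (0 < size p)%N by rewrite size_poly_gt0.
have s0 : (0 < s)%N by rewrite -ltnS (leq_trans _ hs) // ltnS.
have -> : s = (s.-1 + 1)%N by rewrite addn1 prednK.
apply: gradedM; [by apply: IH; rewrite prednK | exact: graded_stretchX].
Qed.

(** [X + f T] is congruent to [X] modulo [f], so [f] divides [stretch f]. The
    cofactor [U] has weight 0: in each coefficient the factor [f] takes up the
    degree allowed beyond [i * deg f]. *)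
Lemma stretch_factor : f != 0 ->
  exists2 U, stretch f = f%:P * U & graded 0 U.
Proof.
move=> f0; have [Q hQ] := stretch_congr f.
exists (1 + Q); first by rewrite hQ; ring.
move=> i; rewrite add0n.
have sf : (0 < size f)%N by rewrite size_poly_gt0.
have := @graded_stretch (size f).-1 f; rewrite prednK // => /(_ (leqnn _) i).
have -> : stretch f = f%:P * (1 + Q) by rewrite hQ; ring.
rewrite coefCM; have [->|U0] := eqVneq (1 + Q)`_i 0; first by rewrite size_poly0.
by rewrite size_mul //; move: sf; case: (size f) => //= a _; move: (size _) => b; lia.

Qed.

(** At a point [x], the Taylor expansion of [p] at [x], in the rescaled
    parameter [f(x) T]. *)
Lemma stretch_eval x p :
  map_poly (horner_eval x) (stretch p) = p \Po (f.[x] *: 'X + x%:P).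
Proof.
rewrite /stretch /= map_comp_poly rmorphD rmorphM /= !map_polyC map_polyX /=.
rewrite /horner_eval hornerX mul_polyC; congr (_ \Po _).
rewrite -map_poly_comp_id0 ?horner0 //.
apply/polyP => i; rewrite coef_map_id0 /= ?hornerC //.
Qed.

End Stretch.

(** * Frobenius and multiple roots over a finite field *)

Section FrobeniusPoly.
Variable F : finFieldType.

Lemma exprD_card (p q : {poly F}) :
  (p + q) ^+ #|F| = p ^+ #|F| + q ^+ #|F|.
Proof.
have [p0 pp charp] := finPcharP F.
apply: exprDn_pchar; have cardF := card_pprimeChar charp.
rewrite [#|F|]cardF pnatX; apply/orP; left.
by rewrite (pnatE _ pp) pchar_poly.
Qed.

Lemma expr_card_comp (f : {poly F}) : f ^+ #|F| = f \Po 'X^#|F|.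
Proof.
elim/poly_ind: f => [|f c IH].
  by rewrite comp_poly0 expr0n; case: #|F| (finNzRing_gt1 F).
rewrite exprD_card exprMn IH comp_polyD comp_polyM comp_polyX comp_polyC.
by rewrite -rmorphXn /= expf_card.
Qed.

Lemma dvdp_expr_card_subC (f : {poly F}) :
  'X^#|F| %| f ^+ #|F| - (f.[0])%:P.
Proof.
rewrite expr_card_comp -[X in X \Po _ - _](subrK (f.[0])%:P).
rewrite comp_polyD comp_polyC addrK.
have /factor_theorem [g ->] : root (f - (f.[0])%:P) 0.
  by rewrite /root !hornerE subrr.
by rewrite subr0 comp_polyM comp_polyX dvdp_mull.
Qed.

Lemma leq_card_multiple_roots (S : {set F}) l (r : {poly F}) :
  r != 0 -> {in S, forall x, ('X - x%:P) ^+ l %| r} ->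
  (l * #|S| <= (size r).-1)%N.
Proof.
move=> r0 hS.
have hd : forall s : seq F, uniq s -> {in s, forall x, ('X - x%:P) ^+ l %| r} ->
    \prod_(x <- s) ('X - x%:P) ^+ l %| r.
  elim=> [|x s IH] /=; first by rewrite big_nil dvd1p.
  case/andP=> xs us hs; rewrite big_cons Gauss_dvdp.
    rewrite hs ?mem_head //= IH // => y ys; apply: hs.
    by rewrite inE ys orbT.
  rewrite coprimep_sym prodrXl.
  apply: coprimep_expl; apply: coprimep_expr.
  by rewrite coprimep_XsubC root_prod_XsubC.
have := hd (enum S) (enum_uniq _); rewrite prodrXl => /(_ _)/(dvdp_leq r0) h.
have {}h : (size ((\prod_(x <- enum S) ('X - x%:P)) ^+ l) <= size r)%N.
  by apply: h => x; rewrite mem_enum; apply: hS.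
have := size_exp (\prod_(x <- enum S) ('X - x%:P)) l.
rewrite size_prod_XsubC -cardE /= mulnC => <-.
by case: (size _) (size r) h => [|a] [|b].
Qed.

End FrobeniusPoly.

(** * Stepanov's auxiliary polynomial *)

Lemma scale_square_of_mul (F : fieldType) (f : {poly F}) (c : F) (r s : {poly F}) : r != 0 ->
  f * r ^+ 2 = c *: s ^+ 2 -> exists g : {poly F}, f = c *: g ^+ 2.
Proof.
move=> r0 e; have [c0|c0] := eqVneq c 0.
  move/eqP: e; rewrite c0 scale0r mulf_eq0 expf_eq0 /= (negbTE r0) orbF.
  by move=> /eqP ->; exists 0; rewrite scale0r.
have : r ^+ 2 %| s ^+ 2 by rewrite -(dvdpZr _ _ c0) -e dvdp_mull.
rewrite dvdp_pexp2r // => /dvdpP [t st]; exists t.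
apply: (@mulIf _ (r ^+ 2)); first by rewrite expf_eq0.
by rewrite e st exprMn scalerAl.
Qed.

Lemma dvdp_Xn_coef (F : fieldType) (p : {poly F}) l :
  (forall i, (i < l)%N -> p`_i = 0) -> 'X^l %| p.
Proof.
move=> h; apply/dvdpP; exists (drop_poly l p).
rewrite -[LHS](poly_take_drop l p); suff -> : take_poly l p = 0 by rewrite add0r.
by apply/polyP => i; rewrite coef_take_poly coef0; case: ifP => // /h.
Qed.

Section Stepanov.
Variables (F : finFieldType) (f : {poly F}) (N D : nat).
Hypothesis cardF : #|F| = N.*2.+1.
Hypothesis nz_f0 : f.[0] != 0.
Hypothesis not_square : forall (c : F) (g : {poly F}), f <> c *: g ^+ 2.
Hypothesis D_gt0 : (0 < D)%N.
Hypothesis sizeD : (D.*2 + size f <= #|F|.+2)%N.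

(** If [r = - s f ^ N] modulo [X ^ q], squaring and multiplying by [f] gives
    [f r ^ 2 = s ^ 2 f ^ q] modulo [X ^ q], and [f ^ q] is the constant [f(0)]
    modulo [X ^ q]. Both sides have degree less than [q], so the congruence is
    an equality and makes [f] a scalar times a square. *)
Lemma stepanov_independent (r s : {poly F}) :
  (size r <= D)%N -> (size s <= D)%N ->
  'X^#|F| %| r + s * f ^+ N -> r = 0 /\ s = 0.
Proof.
move=> sr ss dv.
have f0 : f != 0 by apply: contraNneq nz_f0 => ->; rewrite horner0.
have dv2 : 'X^#|F| %| f * r ^+ 2 - (f.[0])%:P * s ^+ 2.
  have -> : f * r ^+ 2 - (f.[0])%:P * s ^+ 2 =
     (r + s * f ^+ N) * (r - s * f ^+ N) * f
     + s ^+ 2 * (f ^+ #|F| - (f.[0])%:P).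
    by rewrite cardF [f ^+ _.+1]exprS -addnn exprD; ring.
  apply: dvdp_add; first by do 2 apply: dvdp_mulr.
  exact/dvdp_mull/dvdp_expr_card_subC.
have sz2 (p : {poly F}) : (size p <= D)%N -> (size (p ^+ 2) <= D.*2.-1)%N.
  move=> hp; apply: leq_trans (size_polyMleq _ _) _.
  by move: hp; move: (size p) => a; lia.
have sf : (0 < size f)%N by rewrite size_poly_gt0.
have e : f * r ^+ 2 - (f.[0])%:P * s ^+ 2 = 0.
  apply: contraTeq dv2 => nz; apply/negP => /(dvdp_leq nz).
  rewrite size_polyXn ltnNge => /negP; apply.
  apply: leq_trans (size_polyD _ _) _; rewrite geq_max size_polyN.
  have := sz2 _ sr; have := sz2 _ ss.
  have := size_polyMleq f (r ^+ 2); have := size_polyMleq (f.[0])%:P (s ^+ 2).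
  rewrite size_polyC nz_f0 /= => h1 h2 h3 h4; apply/andP; split.
    apply: leq_trans h2 _; move: D_gt0 sizeD sf h4; move: (size f) (size _) (#|F|); lia.
  apply: leq_trans h1 _; move: D_gt0 sizeD sf h3; move: (size f) (size _) (#|F|); lia.
have [r0|r0] := eqVneq r 0; last first.
  have [|g fg] := @scale_square_of_mul F f f.[0] r s r0; last by case: (not_square fg).
  by rewrite -mul_polyC; apply/eqP; rewrite -subr_eq0 e.
split=> //; move: e; rewrite r0 expr0n mulr0 sub0r => /eqP.
by rewrite oppr_eq0 mulf_eq0 polyC_eq0 (negbTE nz_f0) expf_eq0 /= => /eqP.
Qed.

Definition stepanov_poly J (r s : 'I_J -> {poly F}) :=
  \sum_(j < J) (r j + s j * f ^+ N) * ('X^#|F|) ^+ j.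

(** The auxiliary polynomial determines its data: the term [j = 0] is read
    modulo [X ^ q], and the other terms follow after division by [X ^ q]. *)
Lemma stepanov_poly_eq0 J (r s : 'I_J -> {poly F}) :
  (forall j, (size (r j) <= D)%N) -> (forall j, (size (s j) <= D)%N) ->
  stepanov_poly r s = 0 -> forall j, r j = 0 /\ s j = 0.
Proof.
elim: J r s => [|J IH] r s hr hs; first by move=> _ [].
rewrite /stepanov_poly big_ord_recl expr0 mulr1.
have -> : \sum_(i < J) (r (lift ord0 i) + s (lift ord0 i) * f ^+ N) *
      ('X^#|F|) ^+ lift ord0 i =
   'X^#|F| * stepanov_poly (r \o lift ord0) (s \o lift ord0).
  rewrite /stepanov_poly mulr_sumr; apply: eq_bigr => i _ /=.
  by rewrite /bump /= exprS; ring.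
move=> e.
have [|r0 s0] := @stepanov_independent (r ord0) (s ord0) (hr _) (hs _).
  by move/eqP: e; rewrite addr_eq0 => /eqP ->; rewrite dvdpNr dvdp_mulr.
move/eqP: e; rewrite r0 s0 mul0r !add0r mulf_eq0 expf_eq0 polyX_eq0 andbF /=.
move/eqP/IH => h j; have [j' ->|->] := unliftP ord0 j; last by [].
by apply: h => i /=.
Qed.

Section Conditions.
Variables (a : F) (U : {poly {poly F}}) (l J : nat).
Hypothesis stretch_f : stretch f f = f%:P * U.
Hypothesis graded_U : graded f 0 U.
Hypothesis l_le : (l <= #|F|)%N.

(** A lift to [F[X][T]] of the Taylor expansion of the auxiliary polynomial at
    the points [x] with [f(x) ^ N = a]: there [f ^ N] expands as [a U ^ N], and
    [X ^ (q j)] expands as [x ^ j] up to order [q]. It does not depend on [x],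
    and replacing [X ^ (q j)] by [X ^ j] keeps its degrees small: its
    vanishing costs few linear conditions and produces many multiple roots. *)
Definition stepanov_cond (r s : 'I_J -> {poly F}) : {poly {poly F}} :=
  \sum_(j < J) (stretch f (r j) + a%:P%:P * (stretch f (s j) * U ^+ N)) *
     ('X^j)%:P.

Lemma stepanov_condB (r s r' s' : 'I_J -> {poly F}) :
  stepanov_cond (fun j => r j - r' j) (fun j => s j - s' j) =
  stepanov_cond r s - stepanov_cond r' s'.
Proof.
rewrite /stepanov_cond -sumrB; apply: eq_bigr => j _.
rewrite /= !stretchB.
by rewrite -mulrBl; congr (_ * _); rewrite mulrBl mulrBr opprD addrACA.
Qed.

Lemma graded_stepanov_cond (r s : 'I_J -> {poly F}) : (0 < J)%N ->
  (forall j, (size (r j) <= D)%N) -> (forall j, (size (s j) <= D)%N) ->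
  graded f (D.-1 + J.-1) (stepanov_cond r s).
Proof.
move=> J0 hr hs; rewrite /stepanov_cond.
apply: (big_ind (fun p => graded f (D.-1 + J.-1) p)); first exact: graded0.
  by move=> p q; apply: gradedD.
move=> j _; apply: gradedM; last first.
  by apply: gradedC; rewrite size_polyXn prednK ?ltn_ord.
apply: gradedD; first by apply: graded_stretch; rewrite prednK.
rewrite -[D.-1]add0n; apply: gradedM.
  by apply: gradedC; apply: leq_trans (size_polyC_leq1 _) _.
rewrite -[D.-1]addn0; apply: gradedM.
  by apply: graded_stretch; rewrite prednK.
by rewrite -(muln0 N); apply: gradedXn.
Qed.

(** The substitution [X |-> x + f(x) X] is invertible because [f(x)] is not 0,
    so a zero of order [l] at the origin after it is a zero of order [l] at
    [x]. *)
Lemma stepanov_vanish r s x : f.[x] != 0 -> f.[x] ^+ N = a ->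
  (forall k, (k < l)%N -> (stepanov_cond r s)`_k = 0) ->
  ('X - x%:P) ^+ l %| stepanov_poly r s.
Proof.
move=> fx0 fxN cond0.
set w : {poly F} := f.[x] *: 'X + x%:P; set Ux := map_poly (horner_eval x) U : {poly F}.
have fw : f \Po w = f.[x] *: Ux.
  rewrite -stretch_eval stretch_f rmorphM /= map_polyC /=.
  by rewrite mul_polyC.
have condx : 'X^l %| map_poly (horner_eval x) (stepanov_cond r s).
  apply: dvdp_Xn_coef => k hk.
  by rewrite coef_map_id0 /horner_eval ?horner0 // cond0 // horner0.
have condE : map_poly (horner_eval x) (stepanov_cond r s) =
   \sum_(j < J) ((r j \Po w) + (s j \Po w) * (f \Po w) ^+ N) * x%:P ^+ j.
  rewrite /stepanov_cond rmorph_sum /=; apply: eq_bigr => j _.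
  rewrite rmorphM rmorphD /= !rmorphM /= !stretch_eval !map_polyC /= -/w.
  rewrite fw exprZn fxN rmorphXn /= -/Ux /horner_eval hornerC hornerXn.
  by rewrite -mul_polyC (rmorphXn (@polyC F)) mulrCA.
have Xw : 'X^l %| ('X \Po w) ^+ #|F| - x%:P.
  rewrite comp_polyX /w exprD_card -rmorphXn /= expf_card addrK exprZn.
  by rewrite dvdpZr ?expf_neq0 // dvdp_exp2l.
have dvw : 'X^l %| stepanov_poly r s \Po w.
  rewrite -(subrK (map_poly (horner_eval x) (stepanov_cond r s)) (_ \Po w)).
  apply: dvdp_add condx.
  rewrite condE /stepanov_poly rmorph_sum /= -sumrB.
  apply: (big_ind (fun p => 'X^l %| p)) => [|p q|j _]; [exact: dvdp0 | exact: dvdp_add |].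
  rewrite !rmorphM /= rmorphD /= rmorphM /= !rmorphXn /=.
  by rewrite -mulrBr dvdp_mull // subrXX dvdp_mulr.
have := dvdp_comp_poly (f.[x]^-1 *: ('X - x%:P)) dvw.
have -> : (stepanov_poly r s \Po w) \Po (f.[x]^-1 *: ('X - x%:P)) = stepanov_poly r s.
  rewrite -comp_polyA /w comp_polyD comp_polyZ comp_polyX comp_polyC.
  by rewrite scalerA mulfV // scale1r subrK comp_polyXr.
rewrite rmorphXn /= comp_polyX exprZn dvdpZl //.
by rewrite expf_neq0 ?invr_neq0.
Qed.

End Conditions.
End Stepanov.

(** Linear algebra by counting: there are [q ^ #|I|] families [u] and only
    [q ^ (l * E)] possible values of the first coefficients of [V u]. The
    difference of two families with the same values solves the system when
    [V] is additive. *)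
Lemma coef_pigeonhole (F : finFieldType) (I : finType)
    (V : {ffun I -> F} -> {poly {poly F}}) l E :
  (l * E < #|I|)%N ->
  exists u v : {ffun I -> F}, u != v /\
    forall i e, (i < l)%N -> (e < E)%N -> (V u)`_i`_e = (V v)`_i`_e.
Proof.
move=> few.
pose L u : {ffun 'I_l * 'I_E -> F} :=
  [ffun ke : 'I_l * 'I_E => ((V u)`_(nat_of_ord ke.1))`_(nat_of_ord ke.2)].
have /injectivePn [u [v ne_uv eqL]] : ~~ injectiveb L.
  apply/injectiveP => /leq_card; rewrite !card_ffun !card_prod !card_ord.
  by rewrite leq_exp2l ?finNzRing_gt1 // leqNgt few.
exists u, v; split=> // i e lt_il lt_eE.
move/ffunP/(_ (Ordinal lt_il, Ordinal lt_eE)): eqL.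
by rewrite !ffunE.
Qed.

Section StepanovBound.
Variables (F : finFieldType) (f : {poly F}) (N D : nat).
Lemma size_stepanov_poly J (r s : 'I_J -> {poly F}) :
  (forall j, (size (r j) <= D)%N) -> (forall j, (size (s j) <= D)%N) ->
  (size (stepanov_poly f N r s) <= D + (size f).-1 * N + J * #|F|)%N.
Proof.
move=> hr hs; apply: leq_trans (size_sum _ _ _) _; apply/bigmax_leqP => j _.
apply: leq_trans (size_polyMleq _ _) _; rewrite -exprM size_polyXn addnS /=.
apply: leq_add; last by rewrite mulnC leq_mul2r (ltnW (ltn_ord j)) orbT.
apply: leq_trans (size_polyD _ _) _; rewrite geq_max.
rewrite (leq_trans (hr j)) ?leq_addr //=.
apply: leq_trans (size_polyMleq _ _) _.
have := size_poly_exp_leq f N; have := hs j.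
by move: (size (s j)) (size (f ^+ N)) (_ * _)%N => u v w; lia.
Qed.

Hypothesis D_gt0 : (0 < D)%N.

Lemma stepanov_pigeonhole (U : {poly {poly F}}) a l J :
  graded f 0 U -> (l * (D + l * (size f).-1 + J) < 2 * J * D)%N ->
  exists r s : 'I_J -> {poly F},
    [/\ forall j, (size (r j) <= D)%N, forall j, (size (s j) <= D)%N,
        ~ (forall j, r j = 0 /\ s j = 0)
      & forall k, (k < l)%N -> (stepanov_cond f N a U r s)`_k = 0].
Proof.
move=> gU few; set E := (D + l * (size f).-1 + J)%N in few.
have J_gt0 : (0 < J)%N by rewrite lt0n; apply: contraTneq few => ->; rewrite muln0 mul0n.
pose P (u : {ffun bool * 'I_J * 'I_D -> F}) (b : bool) (j : 'I_J) : {poly F} :=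
  \sum_(i < D) u (b, j, i) *: 'X^i.
have coefP u b j i : (P u b j)`_(nat_of_ord i) = u (b, j, i).
  rewrite coef_sum (bigD1 i) //= coefZ coefXn eqxx mulr1 big1 ?addr0 // => i' ne.
  by rewrite coefZ coefXn eq_sym (inj_eq val_inj) (negbTE ne) mulr0.
have sizeP u b j : (size (P u b j) <= D)%N.
  apply: leq_trans (size_sum _ _ _) _; apply/bigmax_leqP => i _.
  by apply: leq_trans (size_scale_leq _ _) _; rewrite size_polyXn.
pose V u := stepanov_cond f N a U (P u false) (P u true).
have /(coef_pigeonhole V) [u [v [ne_uv eqV]]] :
    (l * E < #|{: bool * 'I_J * 'I_D}|)%N.
  by rewrite !card_prod card_bool !card_ord.
have sizeB b j : (size (P u b j - P v b j)%R <= D)%N.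
  by apply: leq_trans (size_polyD _ _) _; rewrite geq_max size_polyN !sizeP.
exists (fun j => P u false j - P v false j), (fun j => P u true j - P v true j).
split; [by move=> j; exact: sizeB | by move=> j; exact: sizeB | move=> eq0 | move=> k lt_kl].
  case/eqP: ne_uv; apply/ffunP => -[[b j] i]; rewrite -!coefP.
  suff -> : P u b j = P v b j by [].
  by apply/eqP; rewrite -subr_eq0; apply/eqP; have [] := eq0 j; case: b.
apply/polyP => e; rewrite coef0; have [lt_eE|le_Ee] := ltnP e E.
  rewrite (stepanov_condB _ _ _ _ (P u false) (P u true) (P v false) (P v true)).
  rewrite !coefB; apply/eqP; rewrite subr_eq0; apply/eqP.
  exact: eqV.
have gV := graded_stepanov_cond N D_gt0 a gU J_gt0 (sizeB false) (sizeB true).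
apply: nth_default; apply: leq_trans (gV k) _; apply: leq_trans le_Ee.
rewrite /E addnAC; have : (k * (size f).-1 <= l * (size f).-1)%N.
  by rewrite leq_mul2r (ltnW lt_kl) orbT.
by move: (k * _)%N (l * _)%N D_gt0 J_gt0 => x y *; lia.
Qed.

Hypothesis cardF : #|F| = N.*2.+1.
Hypothesis nz_f0 : f.[0] != 0.
Hypothesis not_square : forall (c : F) (g : {poly F}), f <> c *: g ^+ 2.
Hypothesis sizeD : (D.*2 + size f <= #|F|.+2)%N.

(** A nonzero auxiliary polynomial vanishes to order [l] at each of the
    counted points, so its degree is at least [l] times their number. *)
Lemma stepanov_bound a l J :
  (l <= #|F|)%N -> (l * (D + l * (size f).-1 + J) < 2 * J * D)%N ->
  (l * #|[set x | (f.[x] != 0%R) && (f.[x] ^+ N == a)%R]| <=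
     D + (size f).-1 * N + J * #|F|)%N.
Proof.
move=> l_le few.
have f0 : f != 0 by apply: contraNneq nz_f0 => ->; rewrite horner0.
have [U hU gU] := stretch_factor f0.
have [r [s [hr hs nz cond]]] := stepanov_pigeonhole a gU few.
have nzp : stepanov_poly f N r s != 0.
  apply/eqP => e; apply: nz => j.
  exact: (stepanov_poly_eq0 cardF nz_f0 not_square D_gt0 sizeD hr hs e).
apply: leq_trans (leq_trans (leq_pred _) (size_stepanov_poly hr hs)).
apply: leq_card_multiple_roots => // x; rewrite inE => /andP [fx0 /eqP fxa].
exact: (stepanov_vanish hU l_le fx0 fxa cond).
Qed.

End StepanovBound.

(** * The quadratic character *)

Section QuadraticCharacter.
Variable F : finFieldType.
Implicit Types x y : F.

Definition quad_char y : int :=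
  if y == 0 then 0 else if is_squareb y then 1 else -1.

Lemma quad_char_sqr y : y != 0 -> quad_char (y ^+ 2) = 1.
Proof.
move=> y0; rewrite /quad_char expf_eq0 (negbTE y0) /=.
suff -> : is_squareb (y ^+ 2) by []. by apply/existsP; exists y.
Qed.

Lemma norm_quad_char y : `|quad_char y| <= 1.
Proof. by rewrite /quad_char; case: ifP => // _; case: ifP. Qed.

Hypothesis odd_char : 2 \notin [pchar F].

Lemma card_odd_finField : #|F| = (#|F|./2).*2.+1.
Proof.
have [p pp charp] := finPcharP F.
have cardF := card_pprimeChar charp.
suff oddF : odd #|F| by rewrite -[LHS]odd_double_half oddF.
rewrite [#|F|]cardF oddX; apply/orP; right.
case: (even_prime pp) => // p2; by case/negP: odd_char; have := charp; rewrite {1}p2.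
Qed.

(** Euler's criterion, from a generator of the cyclic group of units: [g ^ i]
    has trivial [(q - 1) / 2]-th power exactly when [i] is even. *)
Lemma exprf_half_card_eq1 y : y != 0 -> is_squareb y = (y ^+ #|F|./2 == 1).
Proof.
move=> y0; apply/existsP/eqP => [[b /eqP yb]|yN].
  have b0 : b != 0 by apply: contraNneq y0 => b0; rewrite yb b0 expr0n.
  apply: (mulfI b0); rewrite mulr1 -[RHS]expf_card [in RHS]card_odd_finField.
  by rewrite exprS yb -exprM mul2n.
have /cyclicP [g hg] := field_unit_group_cyclic [set: {unit F}]%G.
pose u := finField_unit y0.
have /cycleP [i ui] : u \in <[g]>%g by rewrite -hg inE.
have og : #[g]%g = (#|F|./2).*2.
  by rewrite orderE -hg card_finField_unit [in LHS]card_odd_finField.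
have N0 : (0 < #|F|./2)%N.
  by have := finNzRing_gt1 F; rewrite [#|F| in X in X -> _]card_odd_finField; case: (_./2).
have : (g ^+ (i * #|F|./2) == 1)%g.
  rewrite expgM -ui -val_eqE /= FinRing.val_unitX /=; exact/eqP.
rewrite -order_dvdn og -mul2n dvdn_pmul2r // => /dvdnP [j ij].
exists (val g ^+ j); rewrite -exprM -ij.
by rewrite -FinRing.val_unitX -ui.
Qed.

Lemma quad_charE y : (quad_char y)%:~R = y ^+ #|F|./2.
Proof.
rewrite /quad_char; case: eqP => [->|/eqP y0].
  rewrite expr0n; have := finNzRing_gt1 F.
  by rewrite [#|F| in X in X -> _]card_odd_finField; case: (_./2).
rewrite exprf_half_card_eq1 //; case: eqP => [->//|/eqP yN].
have : (y ^+ #|F|./2) ^+ 2 == 1.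
  rewrite -exprM muln2; apply/eqP; apply: (mulfI y0).
  by rewrite mulr1 -[RHS]expf_card [in RHS]card_odd_finField -exprS.
by rewrite sqrf_eq1 (negbTE yN) => /eqP ->; rewrite mulrN1z.
Qed.

Lemma neq_opp1 : (1 : F) != -1.
Proof.
apply: contra odd_char => /eqP e; rewrite inE /=.
by rewrite mulr2n [X in X + _]e addNr.
Qed.

(** The values 0, 1 and -1 remain distinct in [F], so multiplicativity can be
    checked in [F], where the character is a power map. *)
Lemma quad_charM x y : quad_char (x * y) = quad_char x * quad_char y.
Proof.
have inj (a b : int) : a \in [:: 0; 1; -1] -> b \in [:: 0; 1; -1] ->
    a%:~R = b%:~R :> F -> a = b.
  have n1 := neq_opp1; have n0 := oner_neq0 F.
  have m0 : (-1 : F) != 0 by rewrite oppr_eq0.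
  rewrite !inE => /or3P [] /eqP -> /or3P [] /eqP -> //;
   rewrite ?mulrN1z ?mulr1z ?mulr0z => /eqP;
   by rewrite ?(negbTE n1) ?(negbTE n0) ?(negbTE m0) // eq_sym
      ?(negbTE n1) ?(negbTE n0) ?(negbTE m0).
have range z : quad_char z \in [:: 0; 1; -1].
  by rewrite /quad_char; case: ifP => // _; case: ifP.
apply: inj => //; last by rewrite intrM !quad_charE exprMn.
by have := range x; have := range y; rewrite !inE => /or3P [] /eqP -> /or3P [] /eqP ->.
Qed.

Lemma quad_char_prod (I : Type) (r : seq I) (P : pred I) (E : I -> F) :
  quad_char (\prod_(i <- r | P i) E i) = \prod_(i <- r | P i) quad_char (E i).
Proof.
apply: (big_morph quad_char quad_charM).
by rewrite -(expr1n F 2) quad_char_sqr ?oner_neq0.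
Qed.

End QuadraticCharacter.

(** * Character sums of one variable *)

Section UnivariateSum.
Variable F : finFieldType.
Hypothesis odd_char : 2 \notin [pchar F].

Definition sign_set (f : {poly F}) (a : F) : {set F} :=
  [set x | (f.[x] != 0) && (f.[x] ^+ #|F|./2 == a)].

Lemma sum_quad_char_sign_set (f : {poly F}) :
  \sum_x quad_char f.[x] = #|sign_set f 1|%:Z - #|sign_set f (-1)|%:Z.
Proof.
rewrite -!sum1_card !(big_mkcond (fun x => x \in _)) /= -!natz !natr_sum.
rewrite -sumrB; apply: eq_bigr => x _; rewrite !inE /quad_char.
have [//|y0 /=] := eqVneq f.[x] 0.
have n1 := neq_opp1 odd_char; have := quad_charE odd_char f.[x].
rewrite exprf_half_card_eq1 // /quad_char (negbTE y0) exprf_half_card_eq1 //.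
case: eqP => [->|_ <-]; first by rewrite (negbTE n1).
by rewrite mulrN1z eqxx.
Qed.

Lemma leq_card_sign_sets (f : {poly F}) d : f != 0 -> (size f <= d.+1)%N ->
  (#|F| <= #|sign_set f 1%R| + #|sign_set f (-1)%R| + d)%N.
Proof.
move=> f0 sf; pose Z := [set x | root f x].
have Zd : (#|Z| <= d)%N.
  rewrite cardE -ltnS; apply: leq_trans sf; apply: max_poly_roots => //.
    by apply/allP => x; rewrite mem_enum inE.
  exact: enum_uniq.
apply: leq_trans (leq_add (leqnn _) Zd); rewrite -cardsT.
have -> : [set: F] = sign_set f 1 :|: sign_set f (-1) :|: Z.
  apply/setP => x; rewrite !inE /root; have [|y0 /=] := eqVneq f.[x] 0.
    by rewrite orbT.
  rewrite orbF; have := quad_charE odd_char f.[x].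
  rewrite /quad_char (negbTE y0); case: ifP => _ <-; first by rewrite eqxx.
  by rewrite mulrN1z eqxx orbT.
apply: leq_trans (leq_card_setU _ _) _; rewrite leq_add2r.
exact: leq_card_setU.
Qed.

(** Stepanov's bound with its parameters chosen. With [d = deg f], the best
    [D] is about [(q - d) / 2]. There are [2 J D] unknowns, about [J q], for
    about [l q / 2] conditions up to terms of size [l ^ 2 d] and [l J]; since
    [l ^ 2 <= q], these are absorbed by taking [J = l / 2 + 2 d + 2]. The
    degree of the auxiliary polynomial is then [l q / 2 + O(q)], so after
    division by [l] the main term is the expected [q / 2]. *)
Lemma card_sign_set_le (f : {poly F}) (a : F) l :
  f.[0] != 0 -> (forall (c : F) (g : {poly F}), f <> c *: g ^+ 2) ->
  (l * l <= #|F|)%N -> (16 <= #|F|)%N -> (4 * (size f).-1 <= #|F|)%N ->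
  (2 * l * #|sign_set f a| <= l * #|F| + (5 * (size f).-1 + 6) * #|F|)%N.
Proof.
move=> f0 nsq; have := leqSpred (size f).
have oddF := card_odd_finField odd_char; have := @stepanov_bound F f #|F|./2.
move: oddF; move eN: (#|F|./2) => N.
have -> : sign_set f a = [set x | (f.[x] != 0) && (f.[x] ^+ N == a)].
  by rewrite -eN.
set A := #|[set x | _ ]|.
move=> cardF bound; move: bound.
set d := (size f).-1; set q := #|F| in cardF *.
move=> bound sf l2 q16 q4d.
pose D := ((q.+1 - d)./2)%N; pose h := l./2; pose J := (h + 2 * d + 2)%N.
have D1 : (D.*2 + d <= q.+1)%N by rewrite /D; lia.
have D2 : (q <= D.*2 + d)%N by rewrite /D; lia.
have D0 : (0 < D)%N by lia.
have h1 : (h.*2 <= l)%N by rewrite /h; lia.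
have h2 : (l <= h.*2.+1)%N by rewrite /h; lia.
have l4 : (4 * l <= q)%N.
  have [l_lt|l_ge] := ltnP l 4; first lia.
  by apply: leq_trans l2; rewrite leq_mul2r l_ge orbT.
have sD : (D.*2 + size f <= q.+2)%N by lia.
have few : (l * (D + l * d + J) < 2 * J * D)%N.
  rewrite /J; clearbody h D d q; clear - D1 D2 h1 h2 l4 l2 q16 q4d; nia.
have lq : (l <= q)%N by lia.
have := bound D D0 cardF f0 nsq sD a l J lq few.
have hq : (h.*2 * q <= l * q)%N by rewrite leq_mul2r h1 orbT.
have dN : (d * N.*2 <= d * q)%N by rewrite leq_mul2l cardF leqnSn orbT.
rewrite -/A /J; clearbody A h D d q; clear - D1 hq dN q16; lia.
Qed.

End UnivariateSum.

Section UnivariateBound.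
Variables (R : rcfType) (F : finFieldType).
Hypothesis odd_char : 2 \notin [pchar F].

Lemma exists_nat_sqrt (q : nat) : exists l, (l * l <= q < l.+1 * l.+1)%N.
Proof.
have ex : exists l, (l * l <= q)%N by exists 0%N.
have ub l : (l * l <= q)%N -> (l <= q)%N.
  by case: l => // l; apply: leq_trans; rewrite leq_pmulr.
case: (ex_maxnP ex ub) => l hl hmax; exists l; rewrite hl ltnNge.
by apply/negP => /hmax; rewrite ltnn.
Qed.

Lemma ge1_sqrt_card : 1 <= Num.sqrt (#|F|%:R : R).
Proof.
by rewrite -[X in X <= _]sqrtr1 ler_wsqrtr // ler1n (ltnW (finNzRing_gt1 F)).
Qed.

Lemma norm_sum_quad_char (I : finType) (E : I -> F) :
  `|\sum_i quad_char (E i)| <= #|I|%:Z.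
Proof.
apply: le_trans (ler_norm_sum _ _ _) _.
rewrite -natz -sum1_card natr_sum; apply: ler_sum => i _.
exact: norm_quad_char.
Qed.

(** Stepanov's argument only bounds the two sign sets from above. Together
    they cover the line up to the roots of [f], so neither can be much smaller
    than [q / 2] either. *)
Lemma sum_quad_char_le (f : {poly F}) l :
  f.[0] != 0 -> (forall (c : F) (g : {poly F}), f <> c *: g ^+ 2) ->
  (l * l <= #|F|)%N -> (16 <= #|F|)%N -> (4 * (size f).-1 <= #|F|)%N ->
  `|l%:Z * \sum_x quad_char f.[x]| <= ((6 * (size f).-1 + 6) * #|F|)%:Z.
Proof.
move=> f0 nsq hl q16 q4.
have f_neq0 : f != 0 by apply: contraNneq f0 => ->; rewrite horner0.
have b1 := card_sign_set_le odd_char 1 f0 nsq hl q16 q4.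
have b2 := card_sign_set_le odd_char (-1) f0 nsq hl q16 q4.
have b3 := leq_card_sign_sets odd_char f_neq0 (leqSpred _).
rewrite sum_quad_char_sign_set //; move: b1 b2 b3.
move: #|sign_set _ _| #|sign_set _ _| (size f).-1 => A B d.
move: #|F| hl => q hl b1 b2 b3.
have lq : (l <= q)%N by case: l hl {b1 b2} => // l; apply: leq_trans; rewrite leq_pmulr.
have ld : (l * d <= q * d)%N by rewrite leq_mul2r lq orbT.
have lb3 := leq_mul (leqnn l) b3.
rewrite ler_norml; apply/andP; split; lia.
Qed.

(** Weil's bound for the hyperelliptic curve [y ^ 2 = f(x)], with a worse
    constant. The auxiliary polynomial needs [f(0)] nonzero, which a
    translation achieves as soon as [q > d]; when [q <= 16 + 4 d] the trivial
    bound [q] suffices. *)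
Lemma sum_quad_char_bound (f : {poly F}) d :
  (size f <= d.+1)%N -> (forall (c : F) (g : {poly F}), f <> c *: g ^+ 2) ->
  `|(\sum_x quad_char f.[x])%:~R| <= (12 * d + 16)%:R * Num.sqrt #|F|%:R :> R.
Proof.
move=> sf nsq; set q := #|F|.
have q0 : 0 <= q%:R :> R by [].
have sq1 := ge1_sqrt_card; rewrite -/q in sq1.
have sq0 : 0 <= Num.sqrt (q%:R : R) by exact: sqrtr_ge0.
have f0 : f != 0.
  by apply/eqP => f0; apply: (nsq 0 0); rewrite f0 scale0r.
rewrite -intr_norm; set s := Num.sqrt _ in sq1 sq0 *.
have ss : s * s = q%:R by rewrite -expr2 sqr_sqrtr.
have [small|] := leqP q (16 + 4 * d).
  apply: (@le_trans _ _ q%:R).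
    by rewrite [leRHS]pmulrn ler_int; exact: norm_sum_quad_char.
  rewrite -ss ler_wpM2r // (@le_trans _ _ q%:R) //.
    by rewrite -ss ler_peMr.
  by rewrite ler_nat (leq_trans small) // addnC leq_add2r leq_mul2r orbT.
move=> q_gt; have [b fb] : exists b, f.[b] != 0.
  apply/existsP; apply: contraTT q_gt => /existsPn all0; rewrite -leqNgt.
  have : (#|F| < size f)%N.
    rewrite cardE; apply: max_poly_roots f0 _ (enum_uniq _).
    by apply/allP => x _; have := all0 x; rewrite negbK.
  by rewrite -/q => /leq_trans /(_ sf); lia.
set g := f \Po ('X + b%:P).
have sg : size g = size f by apply: size_comp_poly2; rewrite size_XaddC.
have -> : \sum_x quad_char f.[x] = \sum_x quad_char g.[x].
  rewrite (reindex_inj (addIr b)); apply: eq_bigr => x _.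
  by rewrite horner_comp !hornerE.
have g0 : g.[0] != 0 by rewrite horner_comp !hornerE.
have nsqg (c : F) (h : {poly F}) : g <> c *: h ^+ 2.
  move=> gh; apply: (nsq c (h \Po ('X - b%:P))).
  have -> : f = g \Po ('X - b%:P).
    by rewrite -comp_polyA comp_polyD comp_polyX comp_polyC subrK comp_polyXr.
  by rewrite gh comp_polyZ rmorphXn.
(* l is the integer part of the square root of q, so that s <= 2 l. *)
have [l /andP[l1 l2]] := exists_nat_sqrt q.
have sgd : ((size g).-1 <= d)%N by rewrite sg; case: (size f) sf.
have := sum_quad_char_le g0 nsqg l1; rewrite -/q => /(_ _ _).
have q16 : (16 <= q)%N by lia.
have q4 : (4 * (size g).-1 <= q)%N.
  by apply: leq_trans (ltnW q_gt); apply: leq_trans (leq_addl _ _); rewrite leq_mul2l.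
move=> /(_ q16 q4); move: (\sum_x _) => S.
rewrite normrM -(ler_int R) intrM -pmulrn natrM => bd.
have l_gt0 : (0 < l)%N by case: l l2 {l1 bd} => // ; lia.
have sl : s <= 2 * l%:R.
  rewrite -[leRHS]ger0_norm ?mulr_ge0 // -sqrtr_sqr ler_wsqrtr //.
  rewrite -natrM -natrX ler_nat; apply: ltnW; apply: leq_trans l2 _.
  by rewrite -mulnn leq_mul // mul2n -addnn -addn1 leq_add2l.
have bd2 : s * `|S|%:~R <= s * ((12 * d + 12)%:R * s).
  have S0 : 0 <= `|S|%:~R :> R by rewrite ler0z.
  apply: le_trans (ler_wpM2r S0 sl) _.
  rewrite -mulrA (le_trans (ler_wpM2l _ bd)) //.
  rewrite [s * (_ * s)]mulrCA ss mulrA -natrM ler_wpM2r // ler_nat.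
  by move: sgd; clear; move: (size g).-1 => d'; lia.
move: bd2; rewrite ler_pM2l ?(lt_le_trans _ sq1) // => /le_trans; apply.
by rewrite ler_wpM2r // ler_nat leq_add2l.
Qed.

End UnivariateBound.

(** * Polynomials in the last variable *)

Section LastVariable.
Variables (n : nat) (k : fieldType).
Local Notation A := {mpoly k[n]}.

Definition mnm_init (m : 'X_{1..n.+1}) : 'X_{1..n} :=
  [multinom m (widen_ord (leqnSn n) i) | i < n].

Lemma mnm_init_last_inj (m m' : 'X_{1..n.+1}) :
  mnm_init m = mnm_init m' -> m ord_max = m' ord_max -> m = m'.
Proof.
move=> /mnmP init last; apply/mnmP => i.
have [j ->|->//] := unliftP ord_max i.
have -> : lift ord_max j = widen_ord (leqnSn n) j.
  by apply/val_inj => /=; rewrite /bump leqNgt ltn_ord.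
by have := init j; rewrite !mnmE.
Qed.

Lemma leq_mdeg_init m : (mdeg (mnm_init m) <= mdeg m)%N.
Proof.
rewrite !mdegE big_ord_recr /=; apply: leq_trans (leq_addr _ _).
by apply: leq_sum => i _; rewrite mnmE.
Qed.

Lemma leq_last_mdeg (m : 'X_{1..n.+1}) : (m ord_max <= mdeg m)%N.
Proof. by rewrite mdegE big_ord_recr /= leq_addl. Qed.

Lemma muniE_init (p : {mpoly k[n.+1]}) :
  muni p = \sum_(m <- msupp p) (p@_m *: 'X_[mnm_init m]) *: 'X^(m ord_max).
Proof. exact: muniE. Qed.

Lemma coef_muni (p : {mpoly k[n.+1]}) i :
  (muni p)`_i = \sum_(m <- msupp p | m ord_max == i) p@_m *: 'X_[mnm_init m].
Proof.
rewrite muniE_init coef_sum [RHS]big_mkcond; apply: eq_bigr => m _.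
by rewrite coefZ coefXn eq_sym; case: eqP; rewrite ?mulr1 ?mulr0.
Qed.

Lemma mcoeff_muni (p : {mpoly k[n.+1]}) m :
  ((muni p)`_(m ord_max))@_(mnm_init m) = p@_m.
Proof.
rewrite coef_muni raddf_sum /= [RHS](congr1 (mcoeff m) (mpolyE p)) raddf_sum /=.
rewrite big_mkcond; apply: eq_bigr => m' _.
rewrite !mcoeffZ !mcoeffX; have [->|ne] := eqVneq m' m; first by rewrite !eqxx.
case: eqP => [elast|//]; last by rewrite mulr0.
case: eqP => [einit|//]; case/eqP: ne; exact: mnm_init_last_inj.
Qed.

Lemma muni_inj : injective (@muni n k).
Proof. by move=> p q e; apply/mpolyP => m; rewrite -!mcoeff_muni e. Qed.

Lemma muniX m : muni 'X_[k, m] = 'X_[mnm_init m] *: 'X^(m ord_max).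
Proof. by rewrite muniE_init msuppX big_seq1 mcoeffX eqxx scale1r. Qed.

Lemma muni_surj (P : {poly A}) : exists p, muni p = P.
Proof.
pose ext (m : 'X_{1..n}) (i : nat) : 'X_{1..n.+1} :=
  [multinom (oapp m i (unlift ord_max j)) | j < n.+1].
have ext_init m i : mnm_init (ext m i) = m.
  apply/mnmP => j; rewrite !mnmE.
  have -> : widen_ord (leqnSn n) j = lift ord_max j.
    by apply/val_inj => /=; rewrite /bump leqNgt ltn_ord.
  by rewrite liftK.
have ext_last m i : ext m i ord_max = i by rewrite mnmE unlift_none.
exists (\sum_(i < size P) \sum_(m <- msupp P`_i) (P`_i)@_m *: 'X_[ext m i]).
rewrite raddf_sum -[RHS]coefK poly_def; apply: eq_bigr => i _.
rewrite raddf_sum /= [in RHS](mpolyE P`_i) scaler_suml; apply: eq_bigr => m _.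
by rewrite muniZ muniX ext_init ext_last scalerA mul_mpolyC.
Qed.

Lemma msize_coef_muni (p : {mpoly k[n.+1]}) i :
  (msize (muni p)`_i <= msize p)%N.
Proof.
rewrite coef_muni; apply: leq_trans (msize_sum _ _ _) _.
apply/bigmax_leqP_seq => m pm _.
apply: leq_trans (msizeZ_le _ _) _; rewrite msizeX.
by apply: leq_ltn_trans (leq_mdeg_init m) _; apply: msize_mdeg_lt.
Qed.

Lemma size_muni (p : {mpoly k[n.+1]}) : (size (muni p) <= msize p)%N.
Proof.
rewrite muniE_init; apply: leq_trans (size_sum _ _ _) _.
apply/bigmax_leqP_seq => m pm _.
apply: leq_trans (size_scale_leq _ _) _; rewrite size_polyXn.
by apply: leq_ltn_trans (leq_last_mdeg m) _; apply: msize_mdeg_lt.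
Qed.

End LastVariable.

(** * Points over an extension, and slices *)

Section Evaluation.
Variables (k F : fieldType) (iota : {rmorphism k -> F}).

Definition eval_at n (x : {ffun 'I_n -> F}) : {mpoly k[n]} -> F :=
  meval x \o map_mpoly iota.

HB.instance Definition _ n (x : {ffun 'I_n -> F}) :=
  GRing.RMorphism.copy (eval_at x) (meval x \o map_mpoly iota).

Lemma eval_at_monomial n (x : {ffun 'I_n -> F}) c m :
  eval_at x (c *: 'X_[m]) = iota c * \prod_i x i ^+ m i.
Proof. by rewrite /eval_at /= map_mpolyZ map_mpolyX mevalZ mevalX. Qed.

Lemma eval_atE n (x : {ffun 'I_n -> F}) p :
  eval_at x p = \sum_(m <- msupp p) iota p@_m * \prod_i x i ^+ m i.
Proof.
rewrite [in LHS](mpolyE p) raddf_sum; apply: eq_bigr => m _.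
exact: eval_at_monomial.
Qed.

Lemma eval_atC n (x : {ffun 'I_n -> F}) c : eval_at x c%:MP = iota c.
Proof. by rewrite /eval_at /= map_mpolyC mevalC. Qed.

Definition ffun_rcons n (a : {ffun 'I_n -> F}) (y : F) : {ffun 'I_n.+1 -> F} :=
  [ffun i => oapp a y (unlift ord_max i)].

Definition slice n (a : {ffun 'I_n -> F}) (P : {poly {mpoly k[n]}}) : {poly F} :=
  map_poly (eval_at a) P.

HB.instance Definition _ n (a : {ffun 'I_n -> F}) :=
  GRing.RMorphism.copy (slice a) (map_poly (eval_at a)).

Lemma eval_at_rcons n (a : {ffun 'I_n -> F}) y (p : {mpoly k[n.+1]}) :
  eval_at (ffun_rcons a y) p = (slice a (muni p)).[y].
Proof.
rewrite muniE_init /slice rmorph_sum horner_sum eval_atE; apply: eq_bigr => m _ /=.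
rewrite map_polyZ map_polyXn hornerZ hornerXn /= eval_at_monomial.
rewrite big_ord_recr /= mulrA ffunE unlift_none /=; congr (_ * _ * _).
apply: eq_bigr => i _; rewrite mnmE ffunE.
have -> : widen_ord (leqnSn n) i = lift ord_max i.
  by apply/val_inj => /=; rewrite /bump leqNgt ltn_ord.
by rewrite liftK.
Qed.

End Evaluation.

Lemma sum_ffun_rcons (F : finFieldType) n (V : nmodType) (E : {ffun 'I_n.+1 -> F} -> V) :
  \sum_x E x = \sum_a \sum_y E (ffun_rcons a y).
Proof.
rewrite pair_big /= (reindex (fun ay : {ffun 'I_n -> F} * F => ffun_rcons ay.1 ay.2)) //=.
exists (fun x : {ffun 'I_n.+1 -> F} => ([ffun i => x (lift ord_max i)], x ord_max)).
  move=> [a y] _ /=; congr (_, _); last by rewrite ffunE unlift_none.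
  by apply/ffunP => i; rewrite !ffunE liftK.
move=> x _; apply/ffunP => i; rewrite ffunE /=.
by case: unliftP => [j ->|->] //=; rewrite ffunE.
Qed.

(** * Zeros of polynomials in several variables *)

Lemma mpoly0_const (k : fieldType) (p : {mpoly k[0]}) : exists c, p = c%:MP.
Proof.
exists p@_0%MM; apply/mpolyP => m.
have -> : m = 0%MM by apply/mnmP => -[].
by rewrite mcoeffC eqxx mulr1.
Qed.

Section Zeros.
Variables (k : fieldType) (F : finFieldType) (iota : {rmorphism k -> F}).

Lemma slice_neq0 n (a : {ffun 'I_n -> F}) (P : {poly {mpoly k[n]}}) :
  eval_at iota a (lead_coef P) != 0 -> size (slice iota a P) = size P.
Proof. by move=> ca; apply: size_poly_eq; rewrite -lead_coefE. Qed.

Lemma card_roots_leq (P : {poly F}) : P != 0 ->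
  (#|[set y | root P y]| <= (size P).-1)%N.
Proof.
move=> P0; rewrite -ltnS prednK ?size_poly_gt0 // cardE.
apply: max_poly_roots P0 _ (enum_uniq _).
by apply/allP => y; rewrite mem_enum inE.
Qed.

Definition zeros n (p : {mpoly k[n]}) : {set {ffun 'I_n -> F}} :=
  [set x | eval_at iota x p == 0].

Lemma card_points n : #|{ffun 'I_n -> F}| = (#|F| ^ n)%N.
Proof. by rewrite card_ffun card_ord. Qed.

(** At most [n d q ^ (n - 1)] zeros, multiplied by [q] so as to make sense for
    [n = 0]. A slice on which the leading coefficient does not vanish has at
    most [d] roots, and the other slices are counted by induction. *)
Lemma card_zeros n d (p : {mpoly k[n]}) : p != 0 -> (msize p <= d)%N ->
  (#|zeros p| * #|F| <= n * d * #|F| ^ n)%N.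
Proof.
elim: n p => [|n IH] p p0 pd.
  have [c pc] := mpoly0_const p; rewrite /zeros pc in p0 *.
  rewrite (_ : [set x | _] = set0) ?cards0 //; apply/setP => x.
  rewrite !inE eval_atC fmorph_eq0; apply: contraNF p0 => /eqP ->.
  by rewrite mpolyC0.
set P := muni p.
have P0 : P != 0 by apply: contraNneq p0 => P0; apply/eqP/(@muni_inj n k); rewrite muni0.
have c0 : lead_coef P != 0 by rewrite lead_coef_eq0.
have cd : (msize (lead_coef P) <= d)%N.
  exact: leq_trans (msize_coef_muni _ _) pd.
have slice_count (a : {ffun 'I_n -> F}) :
   (\sum_y (ffun_rcons a y \in zeros p) <= d + (a \in zeros (lead_coef P)) * #|F|)%N.
  have [az|anz] := boolP (a \in _).
    rewrite mul1n; apply: leq_trans (leq_addl _ _); rewrite -[leqRHS]sum1_card.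
    by apply: leq_sum => y _; case: (_ \in _).
  rewrite addn0; move: anz; rewrite inE => /slice_neq0 sz.
  have sP0 : slice iota a P != 0 by rewrite -size_poly_gt0 sz size_poly_gt0.
  have := card_roots_leq sP0; rewrite sz => h.
  have {h} := leq_trans h (leq_trans (leq_pred _) (leq_trans (size_muni p) pd)).
  apply: leq_trans; rewrite -sum1_card [leqRHS]big_mkcond /=; apply: leq_sum => y _.
  by rewrite !inE eval_at_rcons rootE; case: (_ == _).
have cardZ : (#|zeros p| <= d * #|F| ^ n + #|zeros (lead_coef P)| * #|F|)%N.
  rewrite -sum1_card big_mkcond /= (@sum_ffun_rcons _ _ nat).
  apply: (@leq_trans
    (\sum_(a : {ffun 'I_n -> F}) (d + (a \in zeros (lead_coef P)) * #|F|)))%N.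
    apply: leq_sum => a _; apply: leq_trans (slice_count a).
    by apply: leq_sum => y _; case: (_ \in _).
  rewrite big_split /= sum_nat_const -big_distrl /= card_points mulnC leq_add2l.
  by rewrite leq_mul // -sum1_card [leqRHS]big_mkcond /= leq_sum // => a _; case: (_ \in _).
have := IH _ c0 cd; rewrite expnS.
have := leq_mul cardZ (leqnn #|F|).
move: (#|F| ^ n)%N #|zeros _| #|zeros _| #|F| => Q A B q h1 h2.
have := leq_mul h2 (leqnn q); move: h1; lia.
Qed.

End Zeros.

(** * Approximate square roots *)

(** A bound for the coefficients after [j] steps of the square root algorithm;
    what matters is that it depends on [d] and [j] only. *)
Definition approx_bound d j := iter j (fun B => 2 * B + d + 2)%N 1%N.

Lemma approx_boundS d j : approx_bound d j.+1 = (2 * approx_bound d j + d + 2)%N.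
Proof. by []. Qed.

Lemma approx_bound_le d i j : (i <= j)%N -> (approx_bound d i <= approx_bound d j)%N.
Proof.
move=> /subnK <-; elim: (j - i)%N => // l IH; rewrite addSn.
by apply: leq_trans IH _; rewrite approx_boundS; lia.
Qed.

Section ApproximateSquareRoot.
Variables (n : nat) (k : fieldType).
Local Notation A := {mpoly k[n]}.

Definition coef_bounded B (P : {poly A}) := forall i : nat, (msize (P`_i)%R <= B)%N.

Lemma msize_mul_leq (p q : A) B C :
  (msize p <= B)%N -> (msize q <= C)%N -> (msize (p * q) <= (B + C).+1)%N.
Proof.
by move=> hp hq; apply: leq_trans (msizeM_le _ _) _; rewrite ltnS leq_add.
Qed.

Lemma coef_boundedB B (P Q : {poly A}) :
  coef_bounded B P -> coef_bounded B Q -> coef_bounded B (P - Q).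
Proof.
move=> hP hQ i; rewrite coefB; apply: leq_trans (msizeD_le _ _) _.
by rewrite geq_max msizeN hP hQ.
Qed.

Lemma coef_boundedM B C (P Q : {poly A}) :
  coef_bounded B P -> coef_bounded C Q -> coef_bounded (B + C).+1 (P * Q).
Proof.
move=> hP hQ i; rewrite coefM; apply: leq_trans (msize_sum _ _ _) _.
by apply/bigmax_leqP => j _; apply: msize_mul_leq.
Qed.

Lemma coef_boundedZ B C (b : A) (P : {poly A}) :
  (msize b <= B)%N -> coef_bounded C P -> coef_bounded (B + C).+1 (b *: P).
Proof. by move=> hb hP i; rewrite coefZ; apply: msize_mul_leq. Qed.

Definition sqrt_remainder (P : {poly A}) b G :=
  b ^+ 2 *: P - lead_coef P *: G ^+ 2.

Lemma coef_bounded_remainder d B P b G :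
  coef_bounded d P -> (msize b <= B)%N -> coef_bounded B G ->
  coef_bounded (2 * B + d + 2) (sqrt_remainder P b G).
Proof.
move=> hP hb hG.
have e1 : (2 * B + d + 2 = (((B + B).+1 + d).+1))%N by lia.
have e2 : (2 * B + d + 2 = (d + (B + B).+1).+1)%N by lia.
apply: coef_boundedB; first by rewrite e1; apply: (coef_boundedZ _ hP); apply: msize_mul_leq.
by rewrite e2; apply: coef_boundedZ; [apply: hP | apply: coef_boundedM].
Qed.

Hypothesis odd_char : 2 \notin [pchar k].

(** The square root at infinity of a polynomial [P] of degree [2 e] with
    leading coefficient [c]: [b ^ 2 P = c G ^ 2] up to degree less than
    [2 e - j]. The coefficient [rho] of degree [2 e - j - 1] of the remainder is
    cancelled by adding [rho X ^ (e - j - 1)] to [2 c b G], and [b] records the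
    denominators, so that everything stays in [k[x_1, ..., x_n]] and can be
    specialized. For [j = e] the remainder has degree less than [e]. *)
Lemma approx_sqrt d e (P : {poly A}) j :
  size P = e.*2.+1 -> coef_bounded d P -> (j <= e)%N ->
  exists (b : A) (G : {poly A}), [/\ b != 0, size G = e.+1, lead_coef G = b,
     (size (sqrt_remainder P b G) <= e.*2 - j)%N
     & (msize b <= approx_bound d j)%N /\ coef_bounded (approx_bound d j) G].
Proof.
move=> sP hP; have c0 : lead_coef P != 0.
  by rewrite lead_coef_eq0 -size_poly_eq0 sP.
have two0 : (2%:R : A) != 0.
  rewrite -(rmorph_nat (@mpolyC n k)) mpolyC_eq0.
  by move: odd_char; rewrite inE.
elim: j => [_|j IH lt_je].
  exists 1, 'X^e; rewrite oner_neq0 size_polyXn lead_coefXn msize1; split=> //; last first.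
    by split=> // i; rewrite coefXn; case: eqP; rewrite ?msize1 ?msize0.
  rewrite subn0 /sqrt_remainder expr1n scale1r -exprM muln2.
  apply/leq_sizeP => i; rewrite leq_eqVlt => /orP [/eqP <-|lt_i].
    by rewrite coefB coefZ coefXn eqxx mulr1 lead_coefE sP subrr.
  rewrite coefB coefZ coefXn nth_default ?sP // gtn_eqF // mulr0 subrr //.
have [b [G [b0 sG lG sR [hb hG]]]] := IH (ltnW lt_je).
set R := sqrt_remainder P b G in sR; set c := lead_coef P in c0 *.
set t := (e.*2 - j).-1; set rho := R`_t; set u := c * b *+ 2.
have u0 : u != 0 by rewrite /u -mulr_natr !mulf_neq0.
have hR := coef_bounded_remainder hP hb hG; rewrite -/R in hR.
exists (u * b), (u *: G + rho *: 'X^(e - j.+1)).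
have sX : (size (rho *: 'X^(e - j.+1)) < size (u *: G))%N.
  rewrite (size_scale G u0) sG ltnS; apply: leq_trans (size_scale_leq _ _) _.
  by rewrite size_polyXn; lia.
have hub : (msize (u * b) <= approx_bound d j.+1)%N.
  have -> : approx_bound d j.+1 = ((d + approx_bound d j).+1 + approx_bound d j).+1.
    by rewrite approx_boundS; lia.
  apply: (msize_mul_leq _ hb); rewrite /u mulr2n; apply: leq_trans (msizeD_le _ _) _.
  by rewrite maxnn; apply: (msize_mul_leq _ hb); apply: hP.
split.
- by rewrite mulf_neq0.
- by rewrite size_polyDl // size_scale.
- by rewrite lead_coefDl // lead_coefZ lG.
- have -> : sqrt_remainder P (u * b) (u *: G + rho *: 'X^(e - j.+1)) =
    u *: (u *: R - (c * rho *+ 2) *: (G * 'X^(e - j.+1)))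
    - (c * rho ^+ 2) *: 'X^((e - j.+1).*2).
    rewrite /R /sqrt_remainder -/c -muln2 exprM.
    rewrite -!mul_polyC !rmorphM !rmorphMn /= !rmorphM /=; ring.
  apply/leq_sizeP => i le_i; have ti : (t <= i)%N by rewrite /t; lia.
  rewrite coefB [X in _ - X]coefZ coefXn.
  have -> : (i == (e - j.+1).*2) = false by lia.
  rewrite mulr0 subr0 coefZ coefB !coefZ coefMXn.
  have -> : (i < e - j.+1)%N = false by lia.
  have [it|it] := eqVneq i t.
    have -> : (i - (e - j.+1) = e)%N by rewrite it /t; lia.
    have -> : G`_e = b by rewrite -lG lead_coefE sG.
    by rewrite it -/rho /u; ring.
  rewrite !nth_default ?mulr0 ?subrr ?mulr0 //.
    by rewrite sG; move: it ti; rewrite /t; lia.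
  by apply: leq_trans sR _; move: it ti; rewrite /t; lia.
- split=> // i; rewrite coefD; apply: leq_trans (msizeD_le _ _) _; rewrite geq_max.
  apply/andP; split.
    have -> : approx_bound d j.+1 = ((d + approx_bound d j).+1 + approx_bound d j).+1.
      by rewrite approx_boundS; lia.
    apply: (coef_boundedZ _ hG); rewrite /u mulr2n; apply: leq_trans (msizeD_le _ _) _.
    by rewrite maxnn; apply: (msize_mul_leq _ hb); apply: hP.
  rewrite coefZ coefXn; case: eqP => _; last by rewrite mulr0 msize0.
  by rewrite mulr1; apply: hR.
Qed.

End ApproximateSquareRoot.

Section SquareCriteria.
Variable F : fieldType.
Hypothesis odd_char : 2 \notin [pchar F].

Lemma odd_degree_not_square (P : {poly F}) (c : F) (g : {poly F}) :
  P != 0 -> ~~ odd (size P) -> P <> c *: g ^+ 2.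
Proof.
move=> P0 + e; rewrite {}e in P0 *.
move: P0; rewrite scale_poly_eq0 expf_eq0 negb_or /= => /andP [c0 g0].
rewrite size_scale // size_mul //; move: g0; rewrite -size_poly_gt0.
by case: (size g) => // s _; rewrite addSn /= addnS /= oddD addbb.
Qed.

(** If [P] were a scalar times [g ^ 2], the remainder would be, up to a scalar,
    [(t g) ^ 2 - G ^ 2 = (t g - G) (t g + G)] with [t g] and [G] of equal
    leading coefficients. Since 2 is invertible the second factor has degree
    [e], so a nonzero product has degree at least [e]. Unlike the discriminant, this
    remainder detects non-squares among inseparable polynomials too. *)
Lemma sqrt_remainder_not_square (P G : {poly F}) (b c : F) e :
  b != 0 -> c != 0 -> size G = e.+1 ->
  b ^+ 2 *: P - c *: G ^+ 2 != 0 ->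
  (size (b ^+ 2 *: P - c *: G ^+ 2)%R <= e)%N ->
  forall (c' : F) (g : {poly F}), P <> c' *: g ^+ 2.
Proof.
move=> b0 c0 sG; set r := _ - _ => r0 sr c' g Pg.
have G0 : G != 0 by rewrite -size_poly_gt0 sG.
have e1 : (b ^+ 2 * c') *: g ^+ 2 = c *: G ^+ 2 + r.
  by rewrite /r Pg scalerA addrC subrK.
have sG2 : size (c *: G ^+ 2) = e.*2.+1.
  by rewrite size_scale // size_mul // sG addnS /= addSn addnn.
have lt_r : (size r < size (c *: G ^+ 2))%N.
  by rewrite sG2 ltnS (leq_trans sr) // -addnn leq_addr.
have := congr1 (fun p : {poly F} => size p) e1; rewrite size_polyDl // sG2.
have [z|c'0] := eqVneq (b ^+ 2 * c') 0; first by rewrite z scale0r size_poly0.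
have [z|g0] := eqVneq g 0; first by rewrite z expr0n scaler0 size_poly0.
rewrite size_scale // size_mul // => sg2.
have sg : size g = e.+1 by move: sg2; move: (size g); clear; lia.
have := congr1 lead_coef e1; rewrite lead_coefDl // !lead_coefZ !lead_coef_exp.
set lg := lead_coef g; set lG := lead_coef G => lc.
have lg0 : lg != 0 by rewrite lead_coef_eq0.
have lG0 : lG != 0 by rewrite lead_coef_eq0.
set t := lG / lg.
have ct : b ^+ 2 * c' = c * t ^+ 2.
  by apply: (mulIf (expf_neq0 2 lg0)); rewrite lc /t; field.
have re : r = c *: ((t *: g - G) * (t *: g + G)).
  have -> : r = (b ^+ 2 * c') *: g ^+ 2 - c *: G ^+ 2 by rewrite e1 addrC addKr.
  rewrite ct -!mul_polyC !rmorphM /=; ring.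
have sum_size : size (t *: g + G) = e.+1.
  apply/eqP; rewrite eqn_leq; apply/andP; split.
    apply: leq_trans (size_polyD _ _) _; rewrite geq_max sG leqnn andbT.
    by apply: leq_trans (size_scale_leq _ _) _; rewrite sg.
  rewrite ltnNge; apply/negP => /leq_sizeP /(_ e (leqnn _)) /eqP.
  rewrite coefD coefZ -[e in g`_e]/(e.+1.-1) -[e in G`_e]/(e.+1.-1) -{1}sg -sG -!lead_coefE.
  rewrite divfK // -mulr2n -mulr_natr mulf_eq0 (negbTE lG0) orFb.
  by move: odd_char; rewrite inE /= => /negbTE ->.
move: r0 sr; rewrite re scale_poly_eq0 (negbTE c0) orFb mulf_eq0 negb_or => nz.
case/andP: nz => d0 s0.
rewrite size_scale // size_mul // sum_size.
by move: d0; rewrite -size_poly_gt0; move: (size (t *: g - G)); clear; lia.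
Qed.

End SquareCriteria.

(** * Character sums of several variables *)

Section CharacterSum.
Variables (k F : finFieldType) (iota : {rmorphism k -> F}).
Hypothesis odd_char : 2 \notin [pchar F].

Definition char_sum n (f : {mpoly k[n]}) : int :=
  \sum_(x : {ffun 'I_n -> F}) quad_char (eval_at iota x f).

Lemma char_sum_slices n (f : {mpoly k[n.+1]}) :
  char_sum f = \sum_a \sum_y quad_char (slice iota a (muni f)).[y].
Proof.
rewrite /char_sum sum_ffun_rcons; apply: eq_bigr => a _; apply: eq_bigr => y _.
by rewrite eval_at_rcons.
Qed.

Lemma sum_mem (T : finType) (Z : {set T}) (V : numDomainType) :
  \sum_(a : T) (a \in Z)%:R = #|Z|%:R :> V.
Proof.
rewrite -sum1_card natr_sum [RHS]big_mkcond /=; apply: eq_bigr => a _.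
by case: (_ \in _).
Qed.

(** The bound of one variable is used on each slice outside [w = 0], and the
    trivial bound [q] on the other slices, of which there are few. *)
Lemma sliced_bound (R : rcfType) n (f : {mpoly k[n.+1]}) (w : {mpoly k[n]}) d B :
  (msize f <= d)%N -> w != 0 -> (msize w <= B)%N ->
  (forall (a : {ffun 'I_n -> F}), eval_at iota a w != 0 ->
     forall (c : F) (g : {poly F}), slice iota a (muni f) <> c *: g ^+ 2) ->
  `|(char_sum f)%:~R| <= (12 * d + 16 + n * B)%:R *
      (#|F|%:R ^+ n * Num.sqrt #|F|%:R) :> R.
Proof.
move=> fd w0 wB nsq; set q := #|F|; set s := Num.sqrt _.
have s1 : 1 <= s := ge1_sqrt_card R F.
rewrite char_sum_slices rmorph_sum /=.
apply: le_trans (ler_norm_sum _ _ _) _.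
apply: (@le_trans _ _
   (\sum_(a : {ffun 'I_n -> F}) ((12 * d + 16)%:R * s + (a \in zeros iota w)%:R * q%:R))).
  apply: ler_sum => a _; have [az|az] := boolP (a \in zeros iota w).
    rewrite mul1r ler_wpDl ?mulr_ge0 // ?(le_trans ler01) //.
    rewrite -intr_norm [leRHS]pmulrn ler_int; exact: norm_sum_quad_char.
  rewrite mul0r addr0; apply: sum_quad_char_bound => //.
    apply: leq_trans (size_poly _ _) _; apply: leq_trans (size_muni f) _.
    exact: leq_trans fd (leqnSn _).
  by apply: nsq; move: az; rewrite inE.
rewrite big_split /= sumr_const -mulr_suml sum_mem card_points -/q.
rewrite [in leRHS]natrD mulrDl lerD //.
  by rewrite -[leLHS]mulr_natl natrX mulrCA.
have := card_zeros iota w0 wB; rewrite -/q => hz.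
rewrite -natrM; apply: (@le_trans _ _ (n * B * q ^ n)%N%:R); first by rewrite ler_nat.
by rewrite natrM natrX mulrA ler_peMr // mulr_ge0 // exprn_ge0.
Qed.

(** Where neither [b] nor [G] vanishes, [f] and [c] have the same quadratic
    character, and [c] does not involve the last variable. *)
Lemma square_slices_bound n (f : {mpoly k[n.+1]}) (G : {poly {mpoly k[n]}}) b c d B :
  b ^+ 2 *: muni f = c *: G ^+ 2 -> lead_coef G = b -> b != 0 ->
  (size G <= d.+1)%N -> (msize b <= B)%N ->
  `|char_sum f - #|F|%:Z * char_sum c| <= (2 * (d + n * B) * #|F| ^ n)%:Z.
Proof.
move=> e lG b0 sG bB; set q := #|F|.
have -> : q%:Z * char_sum c =
    \sum_(a : {ffun 'I_n -> F}) \sum_(y : F) quad_char (eval_at iota a c).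
  rewrite /char_sum mulr_sumr; apply: eq_bigr => a _.
  by rewrite sumr_const -mulr_natl natz.
rewrite char_sum_slices -sumrB; apply: le_trans (ler_norm_sum _ _ _) _.
apply: (@le_trans _ _ (\sum_(a : {ffun 'I_n -> F})
    ((2 * d)%:R + (a \in zeros iota b)%:R * (2 * q)%:R))); last first.
  rewrite big_split /= sumr_const -mulr_suml sum_mem card_points -/q.
  rewrite -[X in X + _]mulr_natl -!natrM -natrD natz lez_nat.
  have := card_zeros iota b0 bB; rewrite -/q; move: #|zeros _ _| (q ^ n)%N => z Q; lia.
apply: ler_sum => a _; rewrite -sumrB.
have diff2 (u v : F) : `|quad_char u - quad_char v| <= 2.
  apply: le_trans (ler_normB _ _) _; rewrite -[2]/(1 + 1).
  by apply: lerD; apply: norm_quad_char.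
have [az|az] := boolP (a \in zeros iota b).
  rewrite mul1r; apply: (@le_trans _ _ (2 * q)%:R); last by rewrite ler_wpDl.
  apply: le_trans (ler_norm_sum _ _ _) _.
  apply: le_trans (ler_sum _ (fun y _ => diff2 _ _)) _.
  by rewrite sumr_const -[leLHS]mulr_natr natrM.
rewrite mul0r addr0; move: az; rewrite inE => ba.
have sGa : size (slice iota a G) = size G by apply: slice_neq0; rewrite lG.
have Ga0 : slice iota a G != 0.
  by rewrite -size_poly_gt0 sGa size_poly_gt0 -lead_coef_eq0 lG.
have cardZ := leq_trans (card_roots_leq Ga0) (_ : (_ <= d)%N).
have {}cardZ : (#|[set y | root (slice iota a G) y]| <= d)%N.
  by apply: cardZ; rewrite sGa; case: (size G) sG.
apply: le_trans (ler_norm_sum _ _ _) _.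
apply: (@le_trans _ _ (\sum_y 2 * (y \in [set y | root (slice iota a G) y])%:R)); last first.
  by rewrite -mulr_sumr sum_mem natrM ler_wpM2l // ler_nat.
apply: ler_sum => y _; rewrite inE rootE.
have [G0|G0] := eqVneq (slice iota a G).[y] 0; first by rewrite mulr1.
rewrite mulr0 normr_le0 subr_eq0; apply/eqP.
have := congr1 (fun P => (slice iota a P).[y]) e.
rewrite /slice !map_polyZ /= -/(slice iota a (muni f)) -/(slice iota a (G ^+ 2)).
rewrite !rmorphXn /= !hornerZ horner_exp => /(congr1 (@quad_char F)).
by rewrite [LHS]quad_charM // [RHS]quad_charM // !quad_char_sqr // mul1r mulr1.
Qed.

End CharacterSum.

(** The implied constant. It mentions neither the base field nor the
    polynomial, which gives the uniformity of the final estimate. *)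
Fixpoint char_sum_const d n : nat :=
  if n is n'.+1 then
    (char_sum_const d n' + (12 * d + 16)
       + 2 * (n' * (3 * approx_bound d d + 2 * d + 4)))%N
  else 0%N.

Section Dichotomy.
Variable k : finFieldType.
Hypothesis odd_char : 2 \notin [pchar k].

Definition square_up_to_scalar n (f : {mpoly k[n]}) :=
  exists (c : k) (g h : {mpoly k[n]}), h != 0 /\ f * h ^+ 2 = c *: g ^+ 2.

Lemma odd_char_ext (F : fieldType) (iota : {rmorphism k -> F}) : 2 \notin [pchar F].
Proof. by rewrite (fmorph_pchar iota). Qed.

(** If [c h ^ 2 = lam g ^ 2], multiplying by [G ^ 2] turns it into
    [P (b h) ^ 2 = lam (g G) ^ 2]. *)
Lemma square_up_to_scalar_lift n (f : {mpoly k[n.+1]}) (b c : {mpoly k[n]})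
    (G : {poly {mpoly k[n]}}) :
  b != 0 -> b ^+ 2 *: muni f = c *: G ^+ 2 ->
  square_up_to_scalar c -> square_up_to_scalar f.
Proof.
move=> b0 e [lam [g [h [h0 ch]]]].
have [g' mg'] := muni_surj (g *: G); have [h' mh'] := muni_surj ((b * h)%:P).
exists lam, g', h'; split.
  apply: contraNneq (mulf_neq0 b0 h0) => h'0; move: mh'; rewrite h'0 muni0.
  by move/esym/eqP; rewrite polyC_eq0.
apply: (@muni_inj n k); rewrite muniM muniZ !rmorphXn /= mg' mh'.
have -> : muni f * (b * h)%:P ^+ 2 = h ^+ 2 *: (b ^+ 2 *: muni f).
  by rewrite scalerA -rmorphXn /= mulrC mul_polyC -exprMn mulrC.
rewrite e scalerA mulrC ch exprZn scalerA; congr (_ *: _).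
by rewrite mul_mpolyC.
Qed.

Lemma slice_remainder (F : fieldType) (iota : {rmorphism k -> F}) n
    (a : {ffun 'I_n -> F}) (b : {mpoly k[n]}) (P G : {poly {mpoly k[n]}}) :
  slice iota a (sqrt_remainder P b G) =
  eval_at iota a b ^+ 2 *: slice iota a P
    - eval_at iota a (lead_coef P) *: slice iota a G ^+ 2.
Proof.
rewrite /slice /sqrt_remainder rmorphB /= !map_polyZ /= !rmorphXn.
by [].
Qed.

(** Induction on the number of variables, viewing [f] as a polynomial [P] in
    the last one with leading coefficient [c]. When [P] has odd degree, no
    slice with [c(a)] nonzero is a scalar times a square. When it has even
    degree, let [R] be the remainder of its approximate square root [G]. If
    [R] is not 0, the slices are not scalars times squares where [c], [b] and
    the leading coefficient of [R] do not vanish. If [R = 0], then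
    [b ^ 2 P = c G ^ 2] and the alternative for [c] is that for [f]. All of
    this takes place over [k] and is then specialized to [F], so that the
    first alternative is a statement over [k] although the sums in the second
    one run over extensions. *)
Lemma square_or_char_sum_bound (R : rcfType) n d (f : {mpoly k[n]}) :
  (msize f <= d)%N ->
  square_up_to_scalar f \/
  forall (F : finFieldType) (iota : {rmorphism k -> F}),
    `|(char_sum iota f)%:~R| <=
      (char_sum_const d n)%:R * (#|F|%:R ^+ n / Num.sqrt #|F|%:R) :> R.
Proof.
elim: n f => [|n IH] f fd.
  left; have [c ->] := mpoly0_const f; exists c, 1, 1.
  by rewrite oner_neq0; split=> //; rewrite expr1n mulr1 -mul_mpolyC mulr1.
have [->|f0] := eqVneq f 0.
  by left; exists 0, 0, 1; rewrite oner_neq0 mul0r scale0r.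
set P := muni f; set c := lead_coef P.
have P0 : P != 0.
  by apply: contraNneq f0 => P0; apply/eqP/(@muni_inj n k); rewrite muni0.
have c0 : c != 0 by rewrite lead_coef_eq0.
have Pd : coef_bounded d P by move=> i; exact: leq_trans (msize_coef_muni _ _) fd.
have sPd : (size P <= d)%N by apply: leq_trans (size_muni _) fd.
set B := approx_bound d d.
have errE (F : finFieldType) :
    (#|F|%:R ^+ n.+1 / Num.sqrt #|F|%:R : R) = #|F|%:R ^+ n * Num.sqrt #|F|%:R.
  have q0 : 0 < #|F|%:R :> R by rewrite ltr0n ltnW ?finNzRing_gt1.
  have s0 : Num.sqrt #|F|%:R != 0 :> R by rewrite sqrtr_eq0 -ltNge.
  by apply: (mulIf s0); rewrite divfK // -mulrA -expr2 sqr_sqrtr ?ltW // exprSr.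
have slicing (w : {mpoly k[n]}) : w != 0 -> (msize w <= 3 * B + 2 * d + 4)%N ->
   (forall (F : finFieldType) (iota : {rmorphism k -> F}) (a : {ffun 'I_n -> F}),
      eval_at iota a w != 0 ->
      forall (c : F) (g : {poly F}), slice iota a P <> c *: g ^+ 2) ->
   forall (F : finFieldType) (iota : {rmorphism k -> F}),
    `|(char_sum iota f)%:~R| <= (char_sum_const d n.+1)%:R *
      (#|F|%:R ^+ n.+1 / Num.sqrt #|F|%:R) :> R.
  move=> w0 wB nsq F iota; rewrite errE.
  apply: le_trans (sliced_bound (odd_char_ext iota) R fd w0 wB (nsq F iota)) _.
  rewrite ler_wpM2r ?mulr_ge0 ?exprn_ge0 ?sqrtr_ge0 // ler_nat /= -/B.
  move: (_ * (3 * _ + _ + _))%N (char_sum_const d n); clear; lia.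
have [oddP|evenP] := boolP (odd (size P)); last first.
  right; apply: (slicing c c0); first by apply: leq_trans (Pd _) _; lia.
  move=> F iota a ca c' g; apply: odd_degree_not_square.
    by rewrite -size_poly_gt0 slice_neq0 // size_poly_gt0.
  by rewrite slice_neq0.
set e := (size P)./2.
have sP : size P = e.*2.+1 by rewrite -[LHS]odd_double_half oddP.
have ed : (e <= d)%N.
  by move: sPd; rewrite sP => /ltnW; apply: leq_trans; rewrite -addnn leq_addr.
have [b [G [b0 sG lG sR [hb hG]]]] := approx_sqrt odd_char sP Pd (leqnn e).
have eB : (approx_bound d e <= B)%N.
  exact: (approx_bound_le _ ed).
have [R0|R0] := eqVneq (sqrt_remainder P b G) 0; last first.
  right; set r := sqrt_remainder P b G in sR R0.
  have hr : (msize (lead_coef r) <= 2 * B + d + 2)%N.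
    apply: leq_trans (coef_bounded_remainder Pd hb hG _) _; move: eB; lia.
  apply: (slicing (c * b * lead_coef r)).
  - by rewrite !mulf_neq0 // lead_coef_eq0.
  - apply: leq_trans (msize_mul_leq (msize_mul_leq (Pd _) hb) hr) _; move: eB; lia.
  move=> F iota a; rewrite !rmorphM /= !mulf_eq0 !negb_or => /andP [/andP [ca ba] ra].
  have sliceR := slice_remainder iota a b P G.
  apply: (sqrt_remainder_not_square (odd_char_ext iota) ba ca (G := slice iota a G) (e := e)).
  - by rewrite slice_neq0 // lG.
  - by rewrite -sliceR -size_poly_gt0 slice_neq0 // size_poly_gt0.
  - rewrite -sliceR; apply: leq_trans (size_poly _ _) _; apply: leq_trans sR _; lia.
have bPG : b ^+ 2 *: muni f = c *: G ^+ 2.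
  by apply/eqP; rewrite -subr_eq0; apply/eqP.
have [sq|bound] := IH c (Pd _).
  by left; apply: square_up_to_scalar_lift b0 bPG sq.
right=> F iota; rewrite errE.
have sGd : (size G <= d.+1)%N by rewrite sG.
have := square_slices_bound iota (odd_char_ext iota) bPG lG b0 sGd (leq_trans hb eB).
rewrite -(ler_int R) intr_norm rmorphB rmorphM /= => diff.
set q : R := #|F|%:R in diff *; set s := Num.sqrt q.
have q0 : 0 <= q by [].
have s1 : 1 <= s := ge1_sqrt_card R F.
have qn0 : 0 <= q ^+ n by rewrite exprn_ge0.
have main : `|(char_sum iota f)%:~R : R| <= q * ((char_sum_const d n)%:R * (q ^+ n / s))
     + (2 * (d + n * B))%:R * q ^+ n.
  rewrite -[X in `|X|](subrK (q * (char_sum iota c)%:~R)) addrC.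
  apply: le_trans (ler_normD _ _) _; rewrite lerD //.
    by rewrite normrM ger0_norm // ler_wpM2l // bound.
  by rewrite (le_trans diff) // -pmulrn [in leLHS]natrM natrX.
apply: le_trans main _.
have -> : q * ((char_sum_const d n)%:R * (q ^+ n / s)) =
    (char_sum_const d n)%:R * (q ^+ n * s).
  have s0 : s != 0 by rewrite gt_eqF // (lt_le_trans ltr01).
  apply: (mulIf s0); rewrite mulrA mulrA divfK // -!mulrA -expr2 sqr_sqrtr //.
  by rewrite mulrCA [q * _]mulrC.
apply: (@le_trans _ _ ((char_sum_const d n)%:R * (q ^+ n * s) +
   (2 * (d + n * B))%:R * (q ^+ n * s))).
  by rewrite lerD2l ler_wpM2l // ler_peMr.
rewrite -mulrDl -natrD; apply: ler_wpM2r.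
  by rewrite mulr_ge0 // (le_trans ler01).
rewrite ler_nat /= -/B.
by move: (char_sum_const d n) => C; clear; lia.
Qed.

End Dichotomy.

(** * Large extensions, and fractions *)

(** The roots of the separable polynomial [X ^ m - X], for [m] a power of the
    characteristic, are [m] distinct elements of its splitting field. *)
Lemma exists_large_extension (k : finFieldType) M :
  exists (F : finFieldType) (iota : {rmorphism k -> F}), (M <= #|F|)%N.
Proof.
have [p pp charp] := finPcharP k; set m := (p ^ M.+1)%N.
have m_gt1 : (1 < m)%N by rewrite (ltn_exp2l 0) ?prime_gt1.
have m_gt0 := ltnW m_gt1; have m1_gt0 : (0 < m.-1)%N by rewrite -ltnS prednK.
pose Q (R : nzRingType) : {poly R} := 'X^m - 'X.
have QE (R : nzRingType) : Q R = ('X^(m.-1) - 1) * ('X - 0%:P).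
  by rewrite /Q subr0 mulrBl mul1r -exprSr prednK.
have Q0 : Q k != 0.
  by rewrite QE monic_neq0 ?rpredM ?monicXsubC ?monicXnsubC.
have [L [zs QL _]] := FinSplittingFieldFor Q0.
have {}QL : Q L %= \prod_(z <- zs) ('X - z%:P).
  by move: QL; rewrite /Q rmorphB rmorphXn /= map_polyX.
have charL : p \in [pchar L] by rewrite pchar_lalg.
have Uzs : uniq zs.
  rewrite -separable_prod_XsubC -(eqp_separable QL) QE separable_root andbC.
  rewrite /root !hornerE subr_eq0 eq_sym expr0n gtn_eqF ?oner_eq0 //=.
  rewrite cyclotomic.separable_Xn_sub_1 // -subn1 natrB // subr_eq0.
  by rewrite natrX pcharf0 // expr0n gtn_eqF // eq_sym oner_eq0.
exists (FinFieldExtType L), (in_alg L).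
have size_zs : size zs = m.
  apply: succn_inj; rewrite -(size_prod_XsubC _ id).
  by rewrite -(eqp_size QL) size_polyDl size_polyXn // size_polyN size_polyX.
apply: (@leq_trans #|(zs : seq (FinFieldExtType L))|); last exact: max_card.
rewrite (card_uniqP _) // size_zs.
by apply: leq_trans (leqnSn M) _; apply: ltnW; apply: ltn_expl; apply: prime_gt1.
Qed.

Lemma fraction_numden (A : idomainType) (x : {fraction A}) :
  exists n d : A, d != 0 /\ x * FracField.tofrac d = FracField.tofrac n.
Proof.
elim/quotW: x => x; exists (frac x).1, (frac x).2; split; first exact: denom_ratioP.
rewrite -[_ * _]/(FracField.mul _ _) !piE; apply/eqmodP.
rewrite /= FracField.equivfE /FracField.mulf.
by rewrite !numden_Ratio ?mulf_neq0 ?oner_eq0 ?denom_ratioP // !mulr1 mulrC.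
Qed.

(** * From independence to equidistribution *)

Section PatternIndicator.
Variable F : finFieldType.
Variables (I : finType) (S : {set I}).

Definition pattern_at (y : I -> F) i :=
  if i \in S then (y i != 0) && is_squareb (y i) else ~~ is_squareb (y i).

Definition pattern_sign i : int := if i \in S then 1 else -1.

Lemma pattern_at_neq0 y i : pattern_at y i -> y i != 0.
Proof.
rewrite /pattern_at; case: ifP => [_ /andP[] //|_].
by apply: contraNneq => ->; apply/existsP; exists 0; rewrite expr0n.
Qed.

Lemma pattern_factor y i : y i != 0 ->
  1 + pattern_sign i * quad_char (y i) = 2 * (pattern_at y i)%:R.
Proof.
move=> y0; rewrite /pattern_sign /pattern_at /quad_char (negbTE y0) /=.
by case: ifP => _; case: is_squareb.
Qed.

Lemma pattern_factor_range (y : I -> F) i :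
  0 <= 1 + pattern_sign i * quad_char (y i) <= 2.
Proof.
rewrite /pattern_sign /quad_char.
by case: ifP => _; case: ifP => _ //; case: ifP.
Qed.

(** When no [y i] is 0, each factor is 2 or 0 according to the pattern. When
    some [y i] is 0, both terms still lie between 0 and [2 ^ #|I|]. *)
Lemma pattern_indicator (y : I -> F) :
  `|2 ^+ #|I| * ([forall i, pattern_at y i]%:R : int)
    - \prod_i (1 + pattern_sign i * quad_char (y i))|
  <= 2 ^+ #|I| * (\prod_i y i == 0)%:R.
Proof.
have [_|/prodf_neq0 y0] := boolP (\prod_i y i == 0).
  have h1 : 0 <= \prod_i (1 + pattern_sign i * quad_char (y i)) <= 2 ^+ #|I|.
    rewrite prodr_ge0 => [|i _]; last by case/andP: (pattern_factor_range y i).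
    rewrite -prodr_const; apply: ler_prod => i _; exact: pattern_factor_range.
  rewrite mulr1; case/andP: h1; case: [forall i, _] => /=;
   rewrite ?mulr1 ?mulr0; move: (\prod_i _) => a h1 h2; lia.
rewrite mulr0 normr_le0 subr_eq0; apply/eqP.
rewrite (eq_bigr (fun i => 2 * (pattern_at y i)%:R)); last first.
  by move=> i _; apply: pattern_factor; apply: y0.
rewrite big_split /= prodr_const; congr (_ * _).
have [/forallP all_p|/forallPn [i ni]] := boolP [forall i, pattern_at y i].
  by rewrite big1 // => i _; rewrite all_p.
by rewrite (bigD1 i) //= (negbTE ni) mul0r.
Qed.

Hypothesis odd_char : 2 \notin [pchar F].

Lemma expand_pattern_product (y : I -> F) :
  \prod_i (1 + pattern_sign i * quad_char (y i)) =
  \sum_(T : {set I}) (\prod_(i in T) pattern_sign i)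
                     * quad_char (\prod_(i in T) y i).
Proof.
under eq_bigr => i _ do rewrite addrC.
rewrite bigA_distr; apply: eq_bigr => T _.
by rewrite quad_char_prod // -big_split /= [RHS]big_mkcond.
Qed.

Lemma norm_pattern_sign (T : {set I}) : `|\prod_(i in T) pattern_sign i| = 1.
Proof.
rewrite normr_prod big1 // => i _; rewrite /pattern_sign.
by case: ifP; rewrite ?normrN1 ?normr1.
Qed.

End PatternIndicator.

Section PatternCount.
Variables (k F : finFieldType) (iota : {rmorphism k -> F}).
Hypothesis odd_char : 2 \notin [pchar F].
Variables (n m : nat) (f : 'I_m -> {mpoly k[n]}).

Lemma pattern_countE (S : {set 'I_m}) :
  pattern_count f iota S =
  #|[set x : {ffun 'I_n -> F} |
      [forall i, pattern_at S (fun i => eval_at iota x (f i)) i]]|.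
Proof. by []. Qed.

(** The sum of the expanded product over all points: the empty subset gives
    the main term [q ^ n], and every other subset a character sum. *)
Lemma pattern_count_char_sum (S : {set 'I_m}) :
  `|2 ^+ m * (pattern_count f iota S)%:Z - (#|F| ^ n)%:Z| <=
  2 ^+ m * #|zeros iota (\prod_i f i)|%:Z
  + \sum_(T : {set 'I_m} | T != set0) `|char_sum iota (\prod_(i in T) f i)|.
Proof.
pose y (x : {ffun 'I_n -> F}) i := eval_at iota x (f i).
pose prods := \sum_(x : {ffun 'I_n -> F}) \prod_i (1 + pattern_sign S i * quad_char (y x i)).
have near : `|2 ^+ m * (pattern_count f iota S)%:Z - prods| <=
    2 ^+ m * #|zeros iota (\prod_i f i)|%:Z.
  have sumZ (Z : {set {ffun 'I_n -> F}}) : #|Z|%:Z = \sum_x (x \in Z)%:R.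
    by rewrite sum_mem natz.
  rewrite pattern_countE !sumZ !mulr_sumr -sumrB.
  apply: le_trans (ler_norm_sum _ _ _) _; apply: ler_sum => x _; rewrite !inE.
  have := pattern_indicator S (y x); rewrite card_ord rmorph_prod; exact.
have expand : prods = (#|F| ^ n)%:Z + \sum_(T : {set 'I_m} | T != set0)
     (\prod_(i in T) pattern_sign S i) * char_sum iota (\prod_(i in T) f i).
  rewrite /prods (eq_bigr _ (fun x _ => expand_pattern_product S odd_char (y x))).
  rewrite exchange_big /= (bigD1 set0) //=; congr (_ + _).
    rewrite !big_set0 -card_points -sum1_card -natz natr_sum; apply: eq_bigr => x _.
    by rewrite !big_set0 mul1r -(expr1n F 2) quad_char_sqr ?oner_neq0.
  apply: eq_bigr => T _; rewrite /char_sum mulr_sumr; apply: eq_bigr => x _.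
  by rewrite rmorph_prod.
rewrite -(subrK prods (2 ^+ m * _)) -addrA; apply: le_trans (ler_normD _ _) _.
apply: lerD near _; rewrite expand addrC addKr.
apply: le_trans (ler_norm_sum _ _ _) _; apply: ler_sum => T _.
by rewrite normrM norm_pattern_sign mul1r.
Qed.

End PatternCount.

Section Independence.
Variables (n m : nat) (k : finFieldType) (f : 'I_m -> {mpoly k[n]}).
Hypothesis indep : square_independent f.

Lemma prod_ratfun_mem (T : {set 'I_m}) :
  \prod_(i < m) to_ratfun (f i) ^ (if i \in T then 1 else 0 : int) =
  to_ratfun (\prod_(i in T) f i).
Proof.
rewrite /to_ratfun rmorph_prod /= [RHS]big_mkcond; apply: eq_bigr => i _.
by case: ifP => _; rewrite ?expr1z ?expr0z.
Qed.

Lemma independent_not_square (T : {set 'I_m}) :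
  T != set0 -> (forall i, f i != 0) -> ~ square_up_to_scalar (\prod_(i in T) f i).
Proof.
move=> /set0Pn [i0 i0T] f0 [c [g [h [h0 fhg]]]].
have fT0 : \prod_(i in T) f i != 0 by apply/prodf_neq0 => i _.
have c0 : c != 0.
  apply: contraNneq (mulf_neq0 fT0 (expf_neq0 2 h0)) => c0.
  by rewrite fhg c0 scale0r.
have := @indep (fun i => if i \in T then 1 else 0) c _ c0 _ i0.
rewrite i0T => contra; suff : (1 : int) = 0 by [].
apply: contra => [i|]; first by case: ifP.
rewrite prod_ratfun_mem /to_ratfun.
exists (FracField.tofrac (c *: g) / FracField.tofrac h).
have hF : FracField.tofrac h != 0 by rewrite tofrac_eq0.
apply: (mulIf (expf_neq0 2 hF)); rewrite -exprMn divfK // -!rmorphXn /= -!rmorphM /=.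
by rewrite -mulrA fhg mul_mpolyC scalerA exprZn.
Qed.

Lemma independent_neq0 i : f i != 0.
Proof.
apply/eqP => fi0.
have := @indep (fun j => if j \in [set i] then 1 else 0) 1 _ (oner_neq0 _) _ i.
rewrite set11 => contra; suff : (1 : int) = 0 by [].
apply: contra => [j|]; first by case: ifP.
exists 0; rewrite prod_ratfun_mem big_set1 fi0 expr0n /= /to_ratfun.
by rewrite tofrac0 mulr0.
Qed.

End Independence.

Lemma msize_prod_leq (n m : nat) (k : fieldType) (f : 'I_m -> {mpoly k[n]})
    (T : {set 'I_m}) :
  (msize (\prod_(i in T) f i) <= (\sum_(i < m) (msize (f i)).-1).+1)%N.
Proof.
apply: (@leq_trans (\sum_(i in T) (msize (f i)).-1).+1); last first.
  by rewrite ltnS [leqRHS](bigID (mem T)) leq_addr.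
apply: (big_rec2 (fun (p : {mpoly k[n]}) d => msize p <= d.+1)%N).
  by rewrite msize1.
move=> i p d _ pd; have [->|f0] := eqVneq (f i) 0; first by rewrite mul0r msize0.
have [->|p0] := eqVneq p 0; first by rewrite mulr0 msize0.
rewrite msizeM //; move: f0; rewrite -msize_poly_eq0; move: pd; rewrite -addnS.
by move: (msize p) (msize (f i)); lia.
Qed.

Lemma independent_equidistributed (R : realType) (n m : nat) (k : finFieldType)
    (f : 'I_m -> {mpoly k[n]}) d :
  2 \notin [pchar k] -> square_independent f ->
  (\sum_(i < m) (msize (f i)).-1 < d)%N ->
  equidistributed_with f ((n * d + char_sum_const d n)%:R : R).
Proof.
move=> odd_char indep fd F iota S; have f0 := independent_neq0 indep.
have odd_charF := odd_char_ext odd_char iota.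
cbv zeta; set q : R := #|F|%:R; set N := pattern_count f iota S; set s := Num.sqrt q.
set E := q ^+ n / s; have s1 : 1 <= s := ge1_sqrt_card R F.
have q_gt0 : 0 < q by rewrite ltr0n ltnW ?finNzRing_gt1.
have s_gt0 : 0 < s by rewrite (lt_le_trans ltr01).
have ss : s * s = q by rewrite -expr2 sqr_sqrtr ?ltW.
have two0 : 0 < 2 ^+ m :> R by rewrite exprn_gt0.
have fTd (T : {set 'I_m}) : (msize (\prod_(i in T) f i) <= d)%N.
  exact: leq_trans (msize_prod_leq f T) fd.
have all0 : \prod_i f i != 0 by apply/prodf_neq0 => i _.
have alld : (msize (\prod_i f i) <= d)%N.
  by have := fTd setT; rewrite (eq_bigl xpredT) // => i; rewrite inE.
have zerosE : #|zeros iota (\prod_i f i)|%:R <= (n * d)%:R * E :> R.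
  rewrite -(ler_pM2r q_gt0) -natrM -mulrA.
  have -> : E * q = q ^+ n * s.
    by rewrite /E -ss mulrA divfK // gt_eqF.
  apply: (@le_trans _ _ (n * d * #|F| ^ n)%N%:R).
    by rewrite ler_nat card_zeros.
  by rewrite natrM natrX ler_wpM2l // ler_peMr // exprn_ge0 // ltW.
have sums : \sum_(T : {set 'I_m} | T != set0)
     `|(char_sum iota (\prod_(i in T) f i))%:~R|
    <= 2 ^+ m * ((char_sum_const d n)%:R * E) :> R.
  apply: (@le_trans _ _ (\sum_(T : {set 'I_m}) (char_sum_const d n)%:R * E)).
    rewrite big_mkcond; apply: ler_sum => T _; case: ifP => T0; last first.
      by rewrite mulr_ge0 // divr_ge0 ?exprn_ge0 ?ltW.
    have [sq|] := square_or_char_sum_bound odd_char R (fTd T); last exact.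
    by case: (independent_not_square indep T0 f0 sq).
  have card_sets : #|{set 'I_m}| = (2 ^ m)%N.
    by rewrite -cardsT -powersetT card_powerset cardsT card_ord.
  by rewrite sumr_const -[leLHS]mulr_natl card_sets natrX.
have := pattern_count_char_sum iota odd_charF f S.
rewrite -(ler_int R) intr_norm rmorphB rmorphD /= !rmorphM !rmorphXn rmorph_sum /=.
rewrite -!pmulrn -[(1 + 1)%N]/2%N -/q -/N.
rewrite (eq_bigr (fun T : {set 'I_m} => `|(char_sum iota (\prod_(i in T) f i))%:~R|));
  last by move=> T _; rewrite intr_norm.
move=> main; rewrite -(ler_pM2l two0) -[X in X * `|_|]gtr0_norm // -normrM.
rewrite mulrBr mulrCA divff ?gt_eqF // mulr1 natrD mulrDl mulrDr.
apply: le_trans main _; apply: lerD sums.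
by rewrite ler_wpM2l // ltW.
Qed.

(** * From equidistribution to independence *)

Section Converse.
Variables (R : realType) (n m : nat) (k : finFieldType) (f : 'I_m -> {mpoly k[n]}).

(** Over a large enough field every pattern occurs more often than
    [K q ^ (n - 1)] times, hence on more points than a hypersurface of bounded
    degree contains: [q ^ n / 2 ^ m] exceeds [(K + |C|) q ^ (n - 1/2)] as soon
    as [sqrt q > 2 ^ m (K + |C|)]. *)
Lemma equidistributed_many K : equidistributed R f ->
  exists (F : finFieldType) (iota : {rmorphism k -> F}), forall S : {set 'I_m},
    (K * #|F| ^ n < pattern_count f iota S * #|F|)%N.
Proof.
case=> C equi; set M : R := 2 ^+ m * (K%:R + `|C|).
have M0 : 0 <= M by rewrite mulr_ge0 // ?exprn_ge0 // addr_ge0.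
have [F [iota cardF]] := exists_large_extension k (Num.bound (M ^+ 2)).
exists F, iota => S; rewrite ltnNge; apply/negP => few.
have := equi F iota S; cbv zeta; set q : R := #|F|%:R; set s := Num.sqrt q.
set N := pattern_count f iota S in few *.
have s1 : 1 <= s := ge1_sqrt_card R F.
have s_gt0 : 0 < s by rewrite (lt_le_trans ltr01).
have q_gt0 : 0 < q by rewrite ltr0n ltnW ?finNzRing_gt1.
have ss : s * s = q by rewrite -expr2 sqr_sqrtr ?ltW.
have two0 : 0 < 2 ^+ m :> R by rewrite exprn_gt0.
have lt_Ms : M < s.
  rewrite -(@ltr_pXn2r _ 2) ?nnegrE ?(ltW s_gt0) // expr2 [ltRHS]expr2 ss.
  apply: lt_le_trans (archi_boundP (exprn_ge0 2 M0)) _.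
  by rewrite ler_nat.
have qn_gt0 : 0 < q ^+ n by rewrite exprn_gt0.
have Ns : N%:R * s <= K%:R * q ^+ n.
  apply: (@le_trans _ _ (N%:R * q)).
    by rewrite -ss mulrA ler_peMr // mulr_ge0 // ltW.
  by rewrite -natrM -natrX -natrM ler_nat.
rewrite ler_norml => /andP [lo _]; move: lt_Ms; apply/negP; rewrite -leNgt.
have lo' : q ^+ n / 2 ^+ m <= N%:R + C * (q ^+ n / s).
  by rewrite -lerBlDr; move: lo; move: (C * _) (q ^+ n / _) => u v; lra.
rewrite -(ler_pM2r qn_gt0) /M -mulrA -(ler_pdivrMl _ _ two0).
have -> : (2 ^+ m)^-1 * (s * q ^+ n) = (q ^+ n / 2 ^+ m) * s by ring.
apply: le_trans (ler_wpM2r (ltW s_gt0) lo') _.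
rewrite mulrDl -[C * _ * s]mulrA divfK ?gt_eqF // [leRHS]mulrDl.
by apply: lerD Ns _; rewrite ler_pM2r // ler_norm.
Qed.

Lemma equidistributed_neq0 : equidistributed R f -> forall i, f i != 0.
Proof.
move=> equi i; have [F [iota many]] := equidistributed_many 0 equi.
have := many set0; rewrite mul0n muln_gt0 => /andP [+ _].
rewrite pattern_countE card_gt0 => /set0Pn [x]; rewrite inE => /forallP /(_ i).
by move/pattern_at_neq0; apply: contraNneq => ->; rewrite rmorph0.
Qed.

(** Up to squares of rational functions, an exponent -1 may be replaced by 1. *)
Lemma ratfun_square_eq (eps : 'I_m -> int) (lambda : k) :
  (forall i, f i != 0) ->
  (forall i, eps i \in [:: 0; 1; -1]) ->
  is_square (to_ratfun lambda%:MP * \prod_(i < m) to_ratfun (f i) ^ eps i) ->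
  exists g h : {mpoly k[n]}, h != 0 /\
    lambda%:MP * (\prod_(i | eps i != 0) f i) * h ^+ 2 = g ^+ 2.
Proof.
move=> f0 epsP [b]; rewrite /to_ratfun.
pose u i : ratfun n k := if eps i == -1 then FracField.tofrac (f i) else 1.
have uE i : FracField.tofrac (f i) ^ eps i * u i ^+ 2 =
     FracField.tofrac (if eps i != 0 then f i else 1) :> ratfun n k.
  have fF : FracField.tofrac (f i) != 0 by rewrite tofrac_eq0 f0.
  rewrite /u; have := epsP i; rewrite !inE => /or3P [] /eqP ->; rewrite ?eqxx /=.
  - by rewrite expr0z mul1r expr1n tofrac1.
  - by rewrite expr1z expr1n mulr1.
  - by rewrite exprN1 expr2 mulKf.
move=> eb; have [g [d [d0 gd]]] := fraction_numden (b * \prod_i u i).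
exists g, d; split=> //; apply/eqP; rewrite -tofrac_eq; apply/eqP.
rewrite !tofracXn -gd exprMn tofracM tofracXn; congr (_ * _).
rewrite exprMn -eb -mulrA tofracM; congr (_ * _).
rewrite -prodrXl -big_split /= (eq_bigr _ (fun i _ => uE i)) -rmorph_prod /=.
by rewrite [in LHS]big_mkcond.
Qed.

(** A relation [lambda f_T h ^ 2 = g ^ 2] imposes a condition on the signs of
    the [f i] wherever [h] is not 0, so a pattern that breaks it occurs only on
    the zeros of [h]. *)
Lemma pattern_set_zeros (F : finFieldType) (iota : {rmorphism k -> F})
    (lambda : k) (T S : {set 'I_m}) (g h : {mpoly k[n]}) :
  2 \notin [pchar k] -> lambda != 0 ->
  lambda%:MP * (\prod_(i in T) f i) * h ^+ 2 = g ^+ 2 ->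
  quad_char (iota lambda) * \prod_(i in T) pattern_sign S i != 1 ->
  (pattern_count f iota S <= #|zeros iota h|)%N.
Proof.
move=> odd_char l0 e ne; rewrite pattern_countE; apply: subset_leq_card.
apply/subsetP => x; rewrite !inE => /forallP pat; apply: contraNT ne => hx.
have odd_charF := odd_char_ext odd_char iota.
have := congr1 (fun p => quad_char (eval_at iota x p)) e => /=.
rewrite (rmorphXn _ 2 g) rmorphM rmorphM rmorphXn /= eval_atC rmorph_prod /=.
rewrite [LHS]quad_charM // quad_char_sqr // mulr1 quad_charM // quad_char_prod //.
have fx i : eval_at iota x (f i) != 0 by exact: pattern_at_neq0 (pat i).
have gx : eval_at iota x g != 0.
  have := congr1 (eval_at iota x) e.
  rewrite (rmorphXn _ 2 g) rmorphM rmorphM rmorphXn /= eval_atC rmorph_prod.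
  move=> egx; suff : eval_at iota x g ^+ 2 != 0 by rewrite expf_eq0.
  rewrite -egx !mulf_neq0 ?expf_neq0 ?fmorph_eq0 //.
  by apply/prodf_neq0 => i _; apply: fx.
rewrite quad_char_sqr // (eq_bigr (pattern_sign S)) => [->//|i _].
have := pat i; rewrite /pattern_at /pattern_sign /quad_char (negbTE (fx i)) /=.
by case: ifP => _; [move=> -> | move=> /negbTE ->].
Qed.

(** Removing one element [i0] of [T] from a pattern changes the parity of its
    number of non-squares on [T]; hence of the full pattern and its
    modification at [i0], one breaks the sign condition. *)
Lemma equidistributed_independent :
  2 \notin [pchar k] -> equidistributed R f -> square_independent f.
Proof.
move=> odd_char equi eps lambda epsP l0 sq i0; apply/eqP; apply: contraT => eps0.
have [g [h [h0 e]]] := ratfun_square_eq (equidistributed_neq0 equi) epsP sq.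
pose T := [set i | eps i != 0].
have {}e : lambda%:MP * (\prod_(i in T) f i) * h ^+ 2 = g ^+ 2.
  by rewrite -e; congr (_ * _ * _); apply: eq_bigl => i; rewrite inE.
have [F [iota many]] := equidistributed_many (n * msize h) equi.
have odd_charF := odd_char_ext odd_char iota.
suff [S ne] : exists S, quad_char (iota lambda) * \prod_(i in T) pattern_sign S i != 1.
  have le_count := pattern_set_zeros odd_char l0 e ne.
  have := many S; rewrite ltnNge => /negP [].
  apply: leq_trans (card_zeros iota h0 (leqnn _)).
  by rewrite leq_mul2r le_count orbT.
have i0T : i0 \in T by rewrite inE.
have signT : \prod_(i in T) pattern_sign [set: 'I_m] i = 1.
  by rewrite big1 // => i _; rewrite /pattern_sign inE.
have signT0 : \prod_(i in T) pattern_sign [set~ i0] i = -1.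
  rewrite (bigD1 i0) //= big1 => [|i /andP [_ ne]].
    by rewrite /pattern_sign !inE eqxx mulr1.
  by rewrite /pattern_sign !inE ne.
have [l1|ne] := eqVneq (quad_char (iota lambda)) 1.
  by exists [set~ i0]; rewrite signT0 l1.
by exists setT; rewrite signT mulr1.
Qed.

End Converse.

Local Close Scope ring_scope.

Theorem theorem3 (R : realType) (n m : nat) (hn : 0 < n) (hm : 0 < m) :
  (forall (k : finFieldType) (f : 'I_m -> {mpoly k[n]}),
     2 \notin [pchar k]%R ->
     (square_independent f <-> equidistributed R f)) /\
  (exists C : {ffun 'I_m -> nat} -> R,
     forall (k : finFieldType) (f : 'I_m -> {mpoly k[n]}),
       2 \notin [pchar k]%R ->
       square_independent f -> equidistributed R f ->
       equidistributed_with f (C (degrees f))).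
Proof.
pose total (D : {ffun 'I_m -> nat}) := (\sum_(i < m) D i).+1.
pose C (D : {ffun 'I_m -> nat}) : R :=
  ((n * total D + char_sum_const (total D) n)%:R)%R.
have bound (k : finFieldType) (f : 'I_m -> {mpoly k[n]}) :
    2 \notin [pchar k]%R -> square_independent f ->
    equidistributed_with f (C (degrees f)).
  move=> odd_char indep; apply: independent_equidistributed => //.
  by rewrite ltnS; apply: leq_sum => i _; rewrite ffunE.
split=> [k f odd_char|]; last by exists C => k f odd_char indep _; apply: bound.
split=> [indep|equi]; first by exists (C (degrees f)); apply: bound.
exact: equidistributed_independent odd_char equi.
Qed.
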